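(* Let $\chi$ be a non-principal even primitive Dirichlet character modulo $q$, and let $a,x>0$ with $\frac{a^2 q x}{16 \pi^2}\notin \mathbb{Z}_{>0}$. Then \begin{align*} \sum_{n=1}^\infty d_{\chi}(n) K_0(a\sqrt{nx})= \frac{2}{a^2x} L(1,\chi)-\frac{\tau(\chi)}{8 }L (1,\bar{\chi}) + \frac{a^2q\, x}{32\pi^4} \tau( \chi ) \sum_{n=1}^\infty d_{\bar{\chi} }(n) \frac{\log \left(\frac{16\pi^2 n}{a^2q x} \right) }{n^2-\left(\frac{a^2qx}{16\pi^2 } \right)^2}. \end{align*}
   Context: $d_\chi(n)=\sum_{d\mid n}\chi(d)$. $\tau(\chi)=\sum_{h=1}^q\chi(h)e^{2\pi i h/q}$ is the Gauss sum, $L(s,\chi)$ the Dirichlet $L$-function, and $K_0$ the modified Bessel function of the second kind of order $0$. *)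

(* Defs.v *)
From Stdlib Require Import Reals Lra ZArith Znumtheory List.
From Coquelicot Require Import Coquelicot.
Open Scope R_scope.

Definition is_dirichlet_char (q : Z) (chi : Z -> C) : Prop :=
  (1 <= q)%Z /\
  (forall m n : Z, chi (m * n)%Z = Cmult (chi m) (chi n)) /\
  (forall n : Z, chi (n + q)%Z = chi n) /\
  (forall n : Z, chi n = RtoC 0 <-> Z.gcd n q <> 1%Z) /\
  chi 1%Z = RtoC 1.

Definition is_principal (q : Z) (chi : Z -> C) : Prop :=
  forall n : Z, Z.gcd n q = 1%Z -> chi n = RtoC 1.

Definition is_even_char (chi : Z -> C) : Prop := chi (-1)%Z = RtoC 1.

(** Primitive: chi is not induced by a character of a proper divisor modulus d,
    i.e. for no d | q with d < q is chi(n) = 1 for all n coprime to q with n = 1 mod d. *)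
Definition is_primitive (q : Z) (chi : Z -> C) : Prop :=
  forall d : Z, (1 <= d)%Z -> (d | q)%Z -> (d < q)%Z ->
    exists n : Z, Z.gcd n q = 1%Z /\ (n mod d = 1 mod d)%Z /\ chi n <> RtoC 1.

Definition conj_char (chi : Z -> C) : Z -> C := fun n => Cconj (chi n).

Definition d_chi (chi : Z -> C) (n : nat) : C :=
  fold_right Cplus (RtoC 0)
    (map (fun d => chi (Z.of_nat d))
       (filter (fun d => Nat.eqb (n mod d) 0) (seq 1 n))).

Definition e_q (q : Z) (h : nat) : C :=
  (cos (2 * PI * INR h / IZR q), sin (2 * PI * INR h / IZR q)).

Definition gauss_sum (q : Z) (chi : Z -> C) : C :=
  fold_right Cplus (RtoC 0)
    (map (fun h => Cmult (chi (Z.of_nat h)) (e_q q h)) (seq 1 (Z.to_nat q))).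

Definition CSeries (a : nat -> C) : C :=
  (Series (fun n => fst (a n)), Series (fun n => snd (a n))).

(** L(1, chi) = sum_{n >= 1} chi(n)/n (convergent for non-principal chi). *)
Definition L1 (chi : Z -> C) : C :=
  CSeries (fun n => Cdiv (chi (Z.of_nat (S n))) (RtoC (INR (S n)))).

Definition K0 (x : R) : R :=
  RInt_gen (fun t => exp (- x * cosh t)) (at_point 0) (Rbar_locally p_infty).

(* Main.v *)
Require Import Defs.
From Stdlib Require Import Reals ZArith Znumtheory.
From Stdlib Require Import Lra Lia List Permutation FinFun Classical.
From Coquelicot Require Import Coquelicot.
Open Scope R_scope.

(**
  Write α = a √x / 2, A(y) = Σ χ(d) e^{-dy} and B(w) = 1/(e^w - 1).  From
  K_0(2α √(dm)) = ½ ∫_ℝ exp(-α(d e^s + m e^{-s})) ds the left-hand side is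
  ½ ∫_ℝ A(α e^s) B(α e^{-s}) ds.  The partial fraction expansion
  B(w) = 1/w - 1/2 + Σ_k 2w/(w² + 4π²k²) splits this integral into three.  The first
  is a multiple of ∫ A, which is L(1, χ).  For the others, the Gauss sum identity
  q χ(d) = τ(χ) Σ_h χ̄(h) cos(2πhd/q) gives
  A(y) = (τ(χ)/q) Σ_n χ̄(n) 2y/(y² + (2πn/q)²); the second integral is then a
  sum of arctangents, equal to a multiple of τ(χ) L(1, χ̄), and the third a double
  series whose (n, k) term integrates to an elementary logarithm depending only on nk.
  The analysis sees χ only through the cosine identity: it is carried out for the cosine
  transform of an arbitrary real even periodic sequence of mean zero, and applied to the
  real and imaginary parts of τ(χ) χ̄.
*)

(** * Finite sums over lists *)

(* The monoid operation is an explicit parameter, so that rewriting in [R] and [C] yields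
   [Rplus] and [Cplus], which [ring] and [lra] recognise. *)
Class CommMonoid {T : Type} (op : T -> T -> T) (e : T) : Prop := {
  op_assoc : forall x y z, op x (op y z) = op (op x y) z;
  op_comm : forall x y, op x y = op y x;
  op_unit_l : forall x, op e x = x
}.

#[local] Instance Rplus_CommMonoid : CommMonoid Rplus 0.
Proof. split; intros; ring. Qed.

#[local] Instance Cplus_CommMonoid : CommMonoid Cplus (RtoC 0).
Proof. split; intros; ring. Qed.

Definition lsum {T : Type} (op : T -> T -> T) (e : T) {A : Type} (f : A -> T) (l : list A) : T :=
  fold_right op e (map f l).

Notation rsum := (lsum Rplus 0).
Notation csum := (lsum Cplus (RtoC 0)).

Section ListSums.

Context {T : Type} {op : T -> T -> T} {e : T} {CM : CommMonoid op e}.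

Lemma lsum_cons {A} (f : A -> T) a l : lsum op e f (a :: l) = op (f a) (lsum op e f l).
Proof. reflexivity. Qed.

Lemma lsum_app {A} (f : A -> T) l1 l2 :
  lsum op e f (l1 ++ l2) = op (lsum op e f l1) (lsum op e f l2).
Proof.
  induction l1 as [|a l1 IH]; [symmetry; apply op_unit_l|].
  simpl app. rewrite !lsum_cons, IH. apply op_assoc.
Qed.

Lemma lsum_ext {A} (f g : A -> T) l :
  (forall a, In a l -> f a = g a) -> lsum op e f l = lsum op e g l.
Proof. intros E. unfold lsum. f_equal. now apply map_ext_in. Qed.

Lemma lsum_map {A B} (h : A -> B) (f : B -> T) l :
  lsum op e f (map h l) = lsum op e (fun a => f (h a)) l.
Proof. unfold lsum. now rewrite map_map. Qed.

Lemma lsum_unit {A} (l : list A) : lsum op e (fun _ => e) l = e.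
Proof.
  induction l as [|a l IH]; [reflexivity|]. rewrite lsum_cons, IH. apply op_unit_l.
Qed.

Lemma lsum_op {A} (f g : A -> T) l :
  lsum op e (fun a => op (f a) (g a)) l = op (lsum op e f l) (lsum op e g l).
Proof.
  induction l as [|a l IH]; [symmetry; apply op_unit_l|].
  rewrite !lsum_cons, IH, <- !op_assoc. f_equal.
  rewrite !op_assoc. f_equal. apply op_comm.
Qed.

Lemma lsum_swap {A B} (f : A -> B -> T) l m :
  lsum op e (fun a => lsum op e (f a) m) l = lsum op e (fun b => lsum op e (fun a => f a b) l) m.
Proof.
  induction l as [|a l IH]; [symmetry; apply lsum_unit|].
  rewrite lsum_cons, IH, <- lsum_op. reflexivity.
Qed.

Lemma lsum_perm {A} (f : A -> T) l l' : Permutation l l' -> lsum op e f l = lsum op e f l'.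
Proof.
  induction 1 as [|a l l' _ IH|a b l|l l' l'' _ IH1 _ IH2]; rewrite ?lsum_cons.
  - reflexivity.
  - now rewrite IH.
  - rewrite !op_assoc. f_equal. apply op_comm.
  - now rewrite IH1.
Qed.

Lemma lsum_single {A} (f : A -> T) l a :
  NoDup l -> In a l -> (forall b, In b l -> b <> a -> f b = e) -> lsum op e f l = f a.
Proof.
  intros Hl Ha Hf. destruct (in_split a l Ha) as (l1 & l2 & ->).
  apply NoDup_remove_2 in Hl.
  rewrite <- (lsum_perm f _ _ (Permutation_middle l1 l2 a)), lsum_cons.
  rewrite (lsum_ext f (fun _ => e)), lsum_unit; [rewrite op_comm; apply op_unit_l|].
  intros b Hb. apply Hf; [|intros ->; contradiction].
  apply in_app_or in Hb. apply in_or_app. destruct Hb; [left|right; right]; assumption.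
Qed.

Lemma lsum_filter {A} (p : A -> bool) (f : A -> T) l :
  lsum op e f (filter p l) = lsum op e (fun a => if p a then f a else e) l.
Proof.
  induction l as [|a l IH]; [reflexivity|]. simpl filter.
  rewrite lsum_cons, <- IH. destruct (p a); [reflexivity|symmetry; apply op_unit_l].
Qed.

Lemma lsum_seq_split (f : nat -> T) s n m :
  lsum op e f (seq s (n + m)) = op (lsum op e f (seq s n)) (lsum op e f (seq (s + n) m)).
Proof. now rewrite seq_app, lsum_app. Qed.

Lemma lsum_seq_S (f : nat -> T) s n :
  lsum op e f (seq s (S n)) = op (lsum op e f (seq s n)) (f (s + n)%nat).
Proof.
  rewrite seq_S, lsum_app. f_equal. rewrite lsum_cons, op_comm. apply op_unit_l.
Qed.

Lemma lsum_seq_shift (f : nat -> T) k s n :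
  lsum op e f (seq (k + s) n) = lsum op e (fun i => f (k + i)%nat) (seq s n).
Proof.
  rewrite <- (lsum_map (fun i => (k + i)%nat) f). f_equal.
  revert s. induction n as [|n IH]; intros s; [reflexivity|].
  simpl. rewrite <- IH. do 2 f_equal. lia.
Qed.

Lemma lsum_seq_rev (f : nat -> T) n :
  lsum op e f (seq 0 n) = lsum op e (fun k => f (n - 1 - k)%nat) (seq 0 n).
Proof.
  rewrite <- (lsum_map (fun k => n - 1 - k)%nat f). apply lsum_perm, Permutation_sym.
  apply Permutation_map_same_l.
  - apply Injective_map_NoDup_in; [|apply seq_NoDup].
    intros a b Ha Hb. apply in_seq in Ha, Hb. lia.
  - intros k Hk. apply in_map_iff in Hk. destruct Hk as (j & <- & Hj).
    apply in_seq in Hj. apply in_seq. lia.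
Qed.

End ListSums.

Lemma lsum_morphism {T U : Type} (op : T -> T -> T) (e : T) (op' : U -> U -> U) (e' : U)
    (phi : T -> U) {A} (f : A -> T) l :
  phi e = e' -> (forall x y, phi (op x y) = op' (phi x) (phi y)) ->
  phi (lsum op e f l) = lsum op' e' (fun a => phi (f a)) l.
Proof.
  intros He Hop. induction l as [|a l IH]; [exact He|]. rewrite !lsum_cons, Hop, IH. reflexivity.
Qed.

Lemma rsum_mult_l {A} c (f : A -> R) l : rsum (fun a => c * f a) l = c * rsum f l.
Proof. symmetry. apply (lsum_morphism _ _ _ _ (Rmult c)); intros; ring. Qed.

Lemma rsum_mult_r {A} c (f : A -> R) l : rsum (fun a => f a * c) l = rsum f l * c.
Proof. symmetry. apply (lsum_morphism _ _ _ _ (fun x => x * c)); intros; ring. Qed.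

Lemma rsum_le {A} (f g : A -> R) l :
  (forall a, In a l -> f a <= g a) -> rsum f l <= rsum g l.
Proof.
  induction l as [|a l IH]; intros Hfg; [apply Rle_refl|].
  rewrite !lsum_cons. apply Rplus_le_compat; [apply Hfg; now left|].
  apply IH. intros b Hb. apply Hfg. now right.
Qed.

Lemma rsum_ge_0 {A} (f : A -> R) l : (forall a, In a l -> 0 <= f a) -> 0 <= rsum f l.
Proof.
  intros Hf. apply Rle_trans with (rsum (fun _ => 0) l); [right; symmetry; apply lsum_unit|].
  now apply rsum_le.
Qed.

Lemma Rabs_rsum_le {A} (f : A -> R) l : Rabs (rsum f l) <= rsum (fun a => Rabs (f a)) l.
Proof.
  induction l as [|a l IH]; [right; exact Rabs_R0|].
  rewrite !lsum_cons. eapply Rle_trans; [apply Rabs_triang|lra].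
Qed.

Lemma rsum_ge_term {A} (f : A -> R) l a :
  (forall b, 0 <= f b) -> In a l -> f a <= rsum f l.
Proof.
  intros Hf Ha. destruct (in_split a l Ha) as (l1 & l2 & ->).
  rewrite <- (lsum_perm f _ _ (Permutation_middle l1 l2 a)), lsum_cons.
  generalize (rsum_ge_0 f (l1 ++ l2) (fun b _ => Hf b)). lra.
Qed.

Lemma rsum_telescope (f : nat -> R) s n :
  rsum (fun k => f k - f (S k)) (seq s n) = f s - f (s + n)%nat.
Proof.
  induction n as [|n IH]; [rewrite Nat.add_0_r; symmetry; apply Rminus_diag|].
  rewrite lsum_seq_S, IH, Nat.add_succ_r. ring.
Qed.

Lemma continuous_rsum {A} (f : A -> R -> R) l s :
  (forall a, In a l -> continuous (f a) s) -> continuous (fun s => rsum (fun a => f a s) l) s.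
Proof.
  induction l as [|a l IH]; intros Hf; [apply continuous_const|].
  apply (continuous_plus (f a)); [apply Hf; now left|].
  apply IH. intros b Hb. apply Hf. now right.
Qed.

Lemma is_lim_seq_rsum {A} (f : nat -> A -> R) (g : A -> R) l :
  (forall a, In a l -> is_lim_seq (fun n => f n a) (g a)) ->
  is_lim_seq (fun n => rsum (f n) l) (rsum g l).
Proof.
  induction l as [|a l IH]; intros Hf; [apply is_lim_seq_const|].
  apply (is_lim_seq_plus' (fun n => f n a)); [apply Hf; now left|].
  apply IH. intros b Hb. apply Hf. now right.
Qed.

(** * Series *)

Lemma sum_n_rsum (f : nat -> R) n : sum_n f n = rsum f (seq 0 (S n)).
Proof.
  induction n as [|n IH]; [rewrite sum_O; symmetry; apply Rplus_0_r|].
  rewrite sum_Sn, IH, (lsum_seq_S f 0 (S n)). reflexivity.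
Qed.

Lemma is_series_rsum (f : nat -> R) (l : R) :
  is_series f l <-> is_lim_seq (fun n => rsum f (seq 0 n)) l.
Proof.
  assert (E := sum_n_rsum f). rewrite (is_lim_seq_incr_1 (fun n => rsum f (seq 0 n))).
  split; intros Hf; [apply (is_lim_seq_ext (sum_n f))|apply (is_lim_seq_ext _ (sum_n f)) in Hf];
    auto.
Qed.

(* [is_series_ext] with an equality in [R], which [ring] and [field] recognise. *)
Lemma is_series_ext_R (a b : nat -> R) (l : R) :
  (forall n, a n = b n) -> is_series a l -> is_series b l.
Proof. apply is_series_ext. Qed.

Lemma is_series_lsum {A} (f : A -> nat -> R) (c : A -> R) l :
  (forall a, In a l -> is_series (f a) (c a)) ->
  is_series (fun n => rsum (fun a => f a n) l) (rsum c l).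
Proof.
  intros Hf. apply is_series_rsum.
  apply (is_lim_seq_ext (fun n => rsum (fun a => rsum (f a) (seq 0 n)) l));
    [intros n; apply lsum_swap|].
  apply (is_lim_seq_rsum (fun n a => rsum (f a) (seq 0 n))).
  intros a Ha. now apply is_series_rsum, Hf.
Qed.

Lemma rsum_le_series (f : nat -> R) (l : R) n :
  (forall k, 0 <= f k) -> is_series f l -> rsum f (seq 0 n) <= l.
Proof.
  intros Hf Hl. apply is_series_rsum in Hl.
  apply (is_lim_seq_incr_compare _ l Hl).
  intros m. rewrite (lsum_seq_S f 0 m). generalize (Hf (0 + m)%nat). lra.
Qed.

Lemma is_lim_seq_series_remainder (f : nat -> R) (l : R) :
  is_series f l -> is_lim_seq (fun n => l - rsum f (seq 0 n)) 0.
Proof.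
  intros Hf. replace (Finite 0) with (Finite (l - l)) by (f_equal; ring).
  apply is_lim_seq_minus'; [apply is_lim_seq_const|now apply is_series_rsum].
Qed.

Lemma Rabs_series_remainder_le (f : nat -> R) (l : R) n B :
  is_series f l -> (forall m, Rabs (rsum f (seq n m)) <= B) ->
  Rabs (l - rsum f (seq 0 n)) <= B.
Proof.
  intros Hf HB. apply is_series_rsum, (is_lim_seq_incr_n _ n) in Hf.
  apply (is_lim_seq_le (fun m => Rabs (rsum f (seq 0 (m + n)) - rsum f (seq 0 n)))
    (fun _ => B) (Rabs (l - rsum f (seq 0 n))) B); [| |apply is_lim_seq_const].
  - intros m. rewrite Nat.add_comm, lsum_seq_split, Nat.add_0_l, Rplus_minus_l. apply HB.
  - apply (is_lim_seq_abs _ (l - rsum f (seq 0 n))), is_lim_seq_minus';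
      [exact Hf|apply is_lim_seq_const].
Qed.

Lemma Rabs_series_remainder_dominated (f b : nat -> R) (lf lb : R) n :
  is_series f lf -> is_series b lb -> (forall k, Rabs (f k) <= b k) ->
  Rabs (lf - rsum f (seq 0 n)) <= lb - rsum b (seq 0 n).
Proof.
  intros Hf Hb Hfb. apply Rabs_series_remainder_le; [exact Hf|]. intros m.
  assert (Hb0 : forall k, 0 <= b k)
    by (intros k; eapply Rle_trans; [apply Rabs_pos|apply Hfb]).
  generalize (rsum_le_series b lb (n + m) Hb0 Hb). rewrite lsum_seq_split. intros Hlb.
  apply Rle_trans with (rsum b (seq n m)); [|simpl in Hlb; lra].
  eapply Rle_trans; [apply Rabs_rsum_le|]. now apply rsum_le.
Qed.

Lemma ex_series_Rabs_bounded_mult (w b : nat -> R) W :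
  (forall n, Rabs (w n) <= W) -> (forall n, 0 <= b n) -> ex_series b ->
  ex_series (fun n => Rabs (w n * b n)).
Proof.
  intros Hw Hb Hex.
  apply (ex_series_le (V := R_CompleteNormedModule) _ (fun n => W * b n));
    [|now apply (ex_series_scal_l W b)].
  intros n. change (Rabs (Rabs (w n * b n)) <= W * b n).
  rewrite Rabs_Rabsolu, Rabs_mult, (Rabs_pos_eq (b n)) by apply Hb.
  now apply Rmult_le_compat_r.
Qed.

Lemma ex_series_telescope (f a : nat -> R) :
  (forall n, 0 <= f n) -> (forall n, 0 <= a n <= f n - f (S n)) -> ex_series a.
Proof.
  intros Hf Ha.
  destruct (ex_finite_lim_seq_incr (fun n => rsum a (seq 0 n)) (f O)) as [l Hl].
  - intros n. rewrite lsum_seq_S. generalize (Ha (0 + n)%nat). lra.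
  - intros n. apply Rle_trans with (rsum (fun k => f k - f (S k)) (seq 0 n)).
    + apply rsum_le. intros k _. apply Ha.
    + rewrite rsum_telescope. generalize (Hf (0 + n)%nat). lra.
  - exists l. now apply is_series_rsum.
Qed.

Lemma is_lim_seq_bounded (f : nat -> R) (l : R) :
  is_lim_seq f l -> exists B, forall n, Rabs (f n) <= B.
Proof. intros Hf. destruct (filterlim_bounded f) as [B HB]; [now exists l|]. now exists B. Qed.

(* Tannery's theorem. *)
Lemma is_lim_seq_rsum_dominated (f : nat -> nat -> R) (g b : nat -> R) (m : nat -> nat) (l : R) :
  filterlim m eventually eventually ->
  (forall n k, (k < m n)%nat -> Rabs (f n k) <= b k) -> ex_series b ->
  (forall k, is_lim_seq (fun n => f n k) (g k)) -> is_series g l ->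
  is_lim_seq (fun n => rsum (f n) (seq 0 (m n))) l.
Proof.
  intros Hm Hfb [B HB] Hfg Hg.
  assert (Hgb : forall k, Rabs (g k) <= b k).
  { intros k.
    apply (is_lim_seq_le_loc (fun n => Rabs (f n k)) (fun _ => b k) (Rabs (g k)) (b k)).
    - destruct (Hm (fun j => (k < j)%nat)) as [N HN]; [exists (S k); lia|].
      exists N. intros n Hn. apply Hfb, HN, Hn.
    - apply (is_lim_seq_abs _ (g k)), Hfg.
    - apply is_lim_seq_const. }
  apply is_lim_seq_Reals. intros eps Heps.
  assert (Htail := is_lim_seq_series_remainder b B HB). apply is_lim_seq_Reals in Htail.
  destruct (Htail (eps / 3)) as [D HD]; [lra|].
  specialize (HD D (le_n D)). unfold Rdist in HD. rewrite Rminus_0_r in HD.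
  assert (Hhead := is_lim_seq_rsum f g (seq 0 D) (fun k _ => Hfg k)).
  apply is_lim_seq_Reals in Hhead. destruct (Hhead (eps / 3)) as [N1 HN1]; [lra|].
  destruct (Hm (fun j => (D <= j)%nat)) as [N2 HN2]; [now exists D|].
  exists (Nat.max N1 N2). intros n Hn.
  specialize (HN1 n ltac:(lia)). specialize (HN2 n ltac:(lia)). unfold Rdist in *.
  assert (Hblock : Rabs (rsum (f n) (seq D (m n - D))) <= B - rsum b (seq 0 D)).
  { assert (Hb := rsum_le_series b B (m n)
      (fun k => Rle_trans _ _ _ (Rabs_pos _) (Hgb k)) HB).
    replace (m n) with (D + (m n - D))%nat in Hb by lia. rewrite lsum_seq_split in Hb.
    apply Rle_trans with (rsum b (seq D (m n - D))); [|simpl in Hb; lra].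
    eapply Rle_trans; [apply Rabs_rsum_le|]. apply rsum_le. intros k Hk.
    apply in_seq in Hk. apply Hfb. lia. }
  assert (Hrest := Rabs_series_remainder_dominated g b l B D Hg HB Hgb).
  apply Rabs_def2 in HD, HN1. apply Rabs_le_between in Hblock, Hrest.
  replace (m n) with (D + (m n - D))%nat by lia. rewrite lsum_seq_split.
  apply Rabs_def1; simpl; lra.
Qed.

(** * Summation by parts *)

Lemma rsum_by_parts (w f : nat -> R) s n :
  rsum (fun k => w k * f k) (seq s n)
  = rsum w (seq s n) * f (s + n)%nat
    + rsum (fun k => rsum w (seq s (S (k - s))) * (f k - f (S k))) (seq s n).
Proof.
  induction n as [|n IH]; [change (0 = 0 * f (s + 0)%nat + 0); ring|].
  rewrite !(lsum_seq_S _ s n), IH.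
  replace (s + n - s)%nat with n by lia.
  rewrite (lsum_seq_S w s n), Nat.add_succ_r. ring.
Qed.

Section DirichletTest.

Variables (w f : nat -> R) (C : R).
Hypothesis partial_sums_le : forall n, Rabs (rsum w (seq 0 n)) <= C.
Hypothesis f_ge_0 : forall n, 0 <= f n.
Hypothesis f_decreasing : forall n, f (S n) <= f n.

Lemma Rabs_rsum_dirichlet_le s n :
  Rabs (rsum (fun k => w k * f k) (seq s n)) <= 2 * C * f s.
Proof.
  assert (Hblock : forall k, Rabs (rsum w (seq s k)) <= 2 * C).
  { intros k. assert (Hs := partial_sums_le s).
    assert (Hsk := partial_sums_le (s + k)). rewrite lsum_seq_split in Hsk. simpl in Hsk.
    apply Rabs_le_between in Hs, Hsk. apply Rabs_le. lra. }
  rewrite rsum_by_parts. eapply Rle_trans; [apply Rabs_triang|].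
  replace (2 * C * f s) with (2 * C * f (s + n)%nat + 2 * C * (f s - f (s + n)%nat)) by ring.
  rewrite <- rsum_telescope, <- rsum_mult_l. apply Rplus_le_compat.
  - rewrite Rabs_mult, (Rabs_pos_eq (f _)) by apply f_ge_0.
    apply Rmult_le_compat_r; [apply f_ge_0|apply Hblock].
  - eapply Rle_trans; [apply Rabs_rsum_le|]. apply rsum_le. intros k _.
    assert (Hk := f_decreasing k). rewrite Rabs_mult, (Rabs_pos_eq (_ - _)) by lra.
    apply Rmult_le_compat_r; [lra|apply Hblock].
Qed.

Lemma Rabs_dirichlet_remainder_le (l : R) n :
  is_series (fun k => w k * f k) l ->
  Rabs (l - rsum (fun k => w k * f k) (seq 0 n)) <= 2 * C * f n.
Proof.
  intros Hl. apply Rabs_series_remainder_le; [exact Hl|]. apply Rabs_rsum_dirichlet_le.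
Qed.

Lemma ex_series_dirichlet : is_lim_seq f 0 -> ex_series (fun k => w k * f k).
Proof.
  intros Hf. apply ex_series_ext with (fun k => scal (f k) (w k)); [intros k; apply Rmult_comm|].
  apply partial_summation_R; [|exact Hf|].
  - exists C. intros n. rewrite sum_n_rsum. apply partial_sums_le.
  - apply (ex_series_telescope f); [exact f_ge_0|]. intros n. split; [apply norm_ge_0|].
    change (Rabs (f (S n) - f n) <= f n - f (S n)).
    rewrite Rabs_minus_sym, Rabs_pos_eq; generalize (f_decreasing n); lra.
Qed.

End DirichletTest.

(** * Dirichlet convolution *)

Definition divisors (n : nat) : list nat :=
  filter (fun d => Nat.eqb (n mod d) 0) (seq 1 n).

Definition dirichlet_conv (x y : nat -> R) (n : nat) : R :=
  rsum (fun d => x d * y (n / d)%nat) (divisors n).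

Lemma in_divisors n d :
  In d (divisors n) -> (1 <= d)%nat /\ (1 <= n / d)%nat /\ (d * (n / d) = n)%nat.
Proof.
  unfold divisors. rewrite filter_In, in_seq, Nat.eqb_eq. intros [Hd Hmod].
  apply Nat.Div0.div_exact in Hmod. nia.
Qed.

Lemma rsum_multiples (g : nat -> R) d n : (1 <= d)%nat ->
  rsum (fun k => if Nat.eqb (k mod d) 0 then g (k / d)%nat else 0) (seq 1 n)
  = rsum g (seq 1 (n / d)).
Proof.
  intros Hd. induction n as [|n IH]; [now rewrite Nat.Div0.div_0_l|].
  rewrite lsum_seq_S, IH. change (1 + n)%nat with (S n).
  assert (En := Nat.div_mod_eq n d). assert (Bn := Nat.mod_upper_bound n d ltac:(lia)).
  assert (ESn := Nat.div_mod_eq (S n) d).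
  assert (BSn := Nat.mod_upper_bound (S n) d ltac:(lia)).
  destruct (Nat.eqb_spec (S n mod d) 0) as [Hmod|Hmod].
  - replace (S n / d)%nat with (S (n / d)) by nia. now rewrite lsum_seq_S.
  - replace (S n / d)%nat with (n / d)%nat by nia. ring.
Qed.

(* The sum over the lattice points under the hyperbola [d m <= n], read column by column. *)
Lemma rsum_dirichlet_conv x y n :
  rsum (dirichlet_conv x y) (seq 1 n) = rsum (fun d => x d * rsum y (seq 1 (n / d))) (seq 1 n).
Proof.
  set (term := fun k d => x d * (if Nat.eqb (k mod d) 0 then y (k / d)%nat else 0)).
  transitivity (rsum (fun k => rsum (term k) (seq 1 n)) (seq 1 n)).
  - apply lsum_ext. intros k Hk. apply in_seq in Hk.
    replace n with (k + (n - k))%nat by lia. rewrite lsum_seq_split.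
    rewrite (lsum_ext (term k) (fun _ => 0) (seq (1 + k) (n - k))), lsum_unit, Rplus_0_r.
    + unfold dirichlet_conv, divisors, term. rewrite lsum_filter. apply lsum_ext. intros d _.
      destruct (Nat.eqb _ _); ring.
    + intros d Hd. apply in_seq in Hd. unfold term. rewrite Nat.mod_small by lia.
      destruct (Nat.eqb_spec k 0); [lia|ring].
  - rewrite lsum_swap. apply lsum_ext. intros d Hd. apply in_seq in Hd.
    unfold term. rewrite rsum_mult_l, rsum_multiples by lia. reflexivity.
Qed.

Lemma is_series_dirichlet_conv (x y : nat -> R) (X Y : R) :
  ex_series (fun n => Rabs (x (S n))) ->
  is_series (fun n => x (S n)) X -> is_series (fun n => y (S n)) Y ->
  is_series (fun n => dirichlet_conv x y (S n)) (X * Y).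
Proof.
  intros Hx HX HY. apply is_series_rsum in HY.
  destruct (is_lim_seq_bounded _ _ HY) as [B HB].
  apply is_series_rsum.
  apply (is_lim_seq_ext
    (fun n => rsum (fun k => x (S k) * rsum (fun j => y (S j)) (seq 0 (n / S k))) (seq 0 n))).
  { intros n. rewrite <- (lsum_seq_shift (dirichlet_conv x y) 1 0), rsum_dirichlet_conv.
    rewrite (lsum_seq_shift _ 1 0). apply lsum_ext. intros k _.
    now rewrite <- (lsum_seq_shift y 1 0). }
  apply (is_lim_seq_rsum_dominated _ (fun k => x (S k) * Y) (fun k => Rabs (x (S k)) * B)).
  - intros P HP. exact HP.
  - intros n k _. rewrite Rabs_mult. apply Rmult_le_compat_l; [apply Rabs_pos|apply HB].
  - now apply ex_series_scal_r.
  - intros k. apply (is_lim_seq_scal_l _ (x (S k)) Y).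
    apply (is_lim_seq_subseq (fun n => rsum (fun j => y (S j)) (seq 0 n)) _
      (fun n => n / S k)%nat); [|exact HY].
    intros P [N HN]. exists (S k * N)%nat. intros n Hn. apply HN, Nat.div_le_lower_bound; lia.
  - now apply is_series_scal_r.
Qed.

(** * The exponent three halves *)

Definition inv_pow_3_2 (x : R) : R := / (x * sqrt x).

Lemma inv_pow_3_2_pos x : 0 < x -> 0 < inv_pow_3_2 x.
Proof. intros Hx. apply Rinv_0_lt_compat, Rmult_lt_0_compat; [exact Hx|now apply sqrt_lt_R0]. Qed.

Lemma inv_pow_3_2_mult x y :
  0 < x -> 0 < y -> inv_pow_3_2 (x * y) = inv_pow_3_2 x * inv_pow_3_2 y.
Proof.
  intros Hx Hy. unfold inv_pow_3_2. rewrite sqrt_mult by lra.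
  assert (Sx := sqrt_lt_R0 x Hx). assert (Sy := sqrt_lt_R0 y Hy). field. lra.
Qed.

Lemma inv_sqr_le_inv_pow_3_2 x : 1 <= x -> / x ^ 2 <= inv_pow_3_2 x.
Proof.
  intros Hx. assert (Sx := sqrt_lt_R0 x ltac:(lra)). assert (Ex := sqrt_sqrt x ltac:(lra)).
  apply Rinv_le_contravar; [apply Rmult_lt_0_compat; lra|]. simpl. nra.
Qed.

Lemma inv_pow_3_2_telescope x :
  0 < x -> inv_pow_3_2 (x + 1) <= 2 / sqrt x - 2 / sqrt (x + 1).
Proof.
  intros Hx. unfold inv_pow_3_2.
  assert (Hu := sqrt_lt_R0 x Hx). assert (Eu := sqrt_sqrt x ltac:(lra)).
  assert (Hv := sqrt_lt_R0 (x + 1) ltac:(lra)). assert (Ev := sqrt_sqrt (x + 1) ltac:(lra)).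
  set (u := sqrt x) in *. set (v := sqrt (x + 1)) in *.
  assert (Huv : u < v) by nra.
  replace (2 / u - 2 / v) with (2 / (u * v * (u + v))).
  - apply Rmult_le_reg_r with ((x + 1) * v * (u * v * (u + v)));
      [repeat (apply Rmult_lt_0_compat || lra)|].
    field_simplify; [|lra|lra].
    nra.
  - replace 2 with (2 * ((v - u) * (v + u))) at 1 by (replace ((v - u) * (v + u)) with 1; nra).
    field. lra.
Qed.

Lemma ex_series_inv_pow_3_2 : ex_series (fun n => inv_pow_3_2 (INR (S n))).
Proof.
  apply ex_series_incr_1, (ex_series_telescope (fun n => 2 / sqrt (INR (S n)))).
  - intros n. left. apply Rdiv_lt_0_compat; [lra|]. apply sqrt_lt_R0, lt_0_INR. lia.
  - intros n. assert (Hn : 0 < INR (S n)) by (apply lt_0_INR; lia). rewrite (S_INR (S n)). split.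
    + left. apply inv_pow_3_2_pos. lra.
    + now apply inv_pow_3_2_telescope.
Qed.

Lemma ex_series_inv_pow_3_2_mult b :
  0 < b -> ex_series (fun n => inv_pow_3_2 (b * INR (S n))).
Proof.
  intros Hb. apply ex_series_ext with (fun n => inv_pow_3_2 b * inv_pow_3_2 (INR (S n))).
  - intros n. symmetry. apply inv_pow_3_2_mult; [exact Hb|]. apply lt_0_INR. lia.
  - apply (ex_series_scal_l (inv_pow_3_2 b) (fun n => inv_pow_3_2 (INR (S n)))).
    apply ex_series_inv_pow_3_2.
Qed.

(** * Improper integrals *)

Ltac continuous_by_derive :=
  match goal with |- continuous ?f ?s => apply (ex_derive_continuous f s); auto_derive end.

Lemma ex_RInt_continuous_everywhere (f : R -> R) a b :
  (forall s, continuous f s) -> ex_RInt f a b.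
Proof. intros Hf. apply (ex_RInt_continuous (V := R_CompleteNormedModule)). auto. Qed.

Lemma RInt_Chasles_continuous (f : R -> R) a b c :
  (forall s, continuous f s) -> RInt f a b + RInt f b c = RInt f a c.
Proof. intros Hf. apply (RInt_Chasles f); now apply ex_RInt_continuous_everywhere. Qed.

Lemma is_RInt_gen_filterlim (f : R -> R) (Fa Fb : (R -> Prop) -> Prop) {FFa : Filter Fa}
    {FFb : Filter Fb} (l : R) :
  (forall s, continuous f s) ->
  is_RInt_gen f Fa Fb l <->
  filterlim (fun ab => RInt f (fst ab) (snd ab)) (filter_prod Fa Fb) (locally l).
Proof.
  intros Hf. split; intros Hl P HP; specialize (Hl P HP); unfold filtermap, filtermapi in *;
    revert Hl; apply filter_imp; intros [a b].
  - intros (y & Hy & Py). now rewrite (is_RInt_unique _ _ _ _ Hy).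
  - intros Pab. exists (RInt f a b). split; [|exact Pab].
    apply (RInt_correct f). now apply ex_RInt_continuous_everywhere.
Qed.

Lemma Rabs_RInt_le (f g : R -> R) a b :
  (forall s, continuous f s) -> (forall s, continuous g s) ->
  (forall s, Rabs (f s) <= g s) -> Rabs (RInt f a b) <= Rabs (RInt g a b).
Proof.
  intros Hf Hg Hfg.
  assert (Hle : forall a b, a <= b -> Rabs (RInt f a b) <= RInt g a b).
  { clear a b. intros a b Hab.
    eapply Rle_trans; [apply abs_RInt_le; [exact Hab|now apply ex_RInt_continuous_everywhere]|].
    apply RInt_le; try apply ex_RInt_continuous_everywhere; auto.
    intros s. apply continuous_comp; [apply Hf|apply continuous_Rabs]. }
  destruct (Rle_dec a b) as [Hab|Hab].
  - eapply Rle_trans; [now apply Hle|apply Rle_abs].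
  - rewrite <- (opp_RInt_swap f), <- (opp_RInt_swap g) by now apply ex_RInt_continuous_everywhere.
    change (Rabs (- RInt f b a) <= Rabs (- RInt g b a)). rewrite !Rabs_Ropp.
    eapply Rle_trans; [apply Hle; lra|apply Rle_abs].
Qed.

Lemma ex_RInt_gen_dominated (f g : R -> R) (Fa Fb : (R -> Prop) -> Prop)
    {FFa : ProperFilter Fa} {FFb : ProperFilter Fb} :
  (forall s, continuous f s) -> (forall s, continuous g s) ->
  (forall s, Rabs (f s) <= g s) -> ex_RInt_gen g Fa Fb -> ex_RInt_gen f Fa Fb.
Proof.
  intros Hf Hg Hfg [lg Hlg].
  apply (is_RInt_gen_filterlim g Fa Fb lg Hg) in Hlg.
  assert (Cg := proj2 (filterlim_locally_cauchy _) (ex_intro _ lg Hlg)).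
  enough (Cf : exists lf : R,
      filterlim (fun ab => RInt f (fst ab) (snd ab)) (filter_prod Fa Fb) (locally lf)).
  { destruct Cf as [lf Hlf]. exists lf. now apply (is_RInt_gen_filterlim f Fa Fb lf Hf). }
  apply (filterlim_locally_cauchy (U := R_CompleteSpace)). intros eps.
  destruct (Cg (pos_div_2 eps)) as (P & [Qa Qb HQa HQb HQ] & HP).
  exists (fun ab => Qa (fst ab) /\ Qb (snd ab)). split; [now apply Filter_prod with Qa Qb|].
  intros [a b] [a' b'] [Ha Hb] [Ha' Hb']. simpl in *.
  assert (Hleft := HP (a, b) (a', b) (HQ _ _ Ha Hb) (HQ _ _ Ha' Hb)).
  assert (Hright := HP (a', b) (a', b') (HQ _ _ Ha' Hb) (HQ _ _ Ha' Hb')).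
  change (Rabs (RInt g a' b - RInt g a b) < eps / 2) in Hleft.
  change (Rabs (RInt g a' b' - RInt g a' b) < eps / 2) in Hright.
  change (Rabs (RInt f a' b' - RInt f a b) < eps).
  rewrite <- (RInt_Chasles_continuous g a' a b), Rplus_minus_r in Hleft by exact Hg.
  rewrite <- (RInt_Chasles_continuous g a' b b'), Rplus_minus_l in Hright by exact Hg.
  rewrite <- (RInt_Chasles_continuous f a' b b'), <- (RInt_Chasles_continuous f a' a b)
    by exact Hf.
  replace (RInt f a' a + RInt f a b + RInt f b b' - RInt f a b)
    with (RInt f a' a + RInt f b b') by ring.
  eapply Rle_lt_trans; [apply Rabs_triang|].
  generalize (Rabs_RInt_le f g a' a Hf Hg Hfg) (Rabs_RInt_le f g b b' Hf Hg Hfg). lra.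
Qed.

Lemma is_RInt_gen_antiderivative (G f : R -> R) (Fa Fb : (R -> Prop) -> Prop) {FFa : Filter Fa}
    {FFb : Filter Fb} (la lb : R) :
  (forall s, is_derive G s (f s)) -> (forall s, continuous f s) ->
  filterlim G Fa (locally la) -> filterlim G Fb (locally lb) ->
  is_RInt_gen f Fa Fb (lb - la).
Proof.
  intros HG Hf Ha Hb.
  assert (E : forall s, Derive G s = f s) by (intros s; now apply is_derive_unique).
  apply (is_RInt_gen_ext (Derive G)).
  - apply filter_forall. intros ab s _. apply E.
  - apply is_RInt_gen_Derive; try assumption; apply filter_forall; intros ab s _.
    + eexists. apply HG.
    + apply (continuous_ext f); [intros t; now rewrite E|apply Hf].
Qed.

Notation is_RInt_line f l :=
  (is_RInt_gen f (Rbar_locally m_infty) (Rbar_locally p_infty) l).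

Lemma is_RInt_line_filterlim (f : R -> R) (l : R) :
  (forall s, continuous f s) ->
  is_RInt_line f l <->
  filterlim (fun ab => RInt f (fst ab) (snd ab))
    (filter_prod (Rbar_locally m_infty) (Rbar_locally p_infty)) (locally l).
Proof. apply is_RInt_gen_filterlim; typeclasses eauto. Qed.

Lemma filter_line_covers a b :
  filter_prod (Rbar_locally m_infty) (Rbar_locally p_infty)
    (fun uv => fst uv <= a /\ b <= snd uv).
Proof.
  apply Filter_prod with (fun u => u <= a) (fun v => b <= v); [| |auto].
  - exists a. intros u Hu. lra.
  - exists b. intros v Hv. lra.
Qed.

Lemma filter_line_le :
  filter_prod (Rbar_locally m_infty) (Rbar_locally p_infty) (fun uv => fst uv <= snd uv).
Proof. generalize (filter_line_covers 0 0). apply filter_imp. intros uv. lra. Qed.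

Lemma is_RInt_line_ext (f g : R -> R) (l : R) :
  (forall s, f s = g s) -> is_RInt_line f l -> is_RInt_line g l.
Proof.
  intros E. apply is_RInt_gen_ext. apply filter_forall. intros ab s _. apply E.
Qed.

Lemma is_RInt_line_le (f g : R -> R) (lf lg : R) :
  (forall s, Rabs (f s) <= g s) -> is_RInt_line f lf -> is_RInt_line g lg -> Rabs lf <= lg.
Proof.
  intros Hfg Hf Hg.
  apply (RInt_gen_norm (V := R_CompleteNormedModule) f g _ _ filter_line_le); [|exact Hf|exact Hg].
  apply filter_forall. intros ab s _. apply Hfg.
Qed.

Lemma is_RInt_line_0 : is_RInt_line (fun _ => 0) 0.
Proof.
  apply is_RInt_line_filterlim; [intros s; apply continuous_const|].
  apply (filterlim_ext (fun _ => 0)); [|apply filterlim_const].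
  intros ab. rewrite RInt_const. symmetry. apply Rmult_0_r.
Qed.

Lemma is_RInt_line_rsum {A} (f : A -> R -> R) (c : A -> R) l :
  (forall a, In a l -> is_RInt_line (f a) (c a)) ->
  is_RInt_line (fun s => rsum (fun a => f a s) l) (rsum c l).
Proof.
  induction l as [|a l IH]; intros Hf; [apply is_RInt_line_0|].
  apply (is_RInt_gen_plus (f a)); [apply Hf; now left|].
  apply IH. intros b Hb. apply Hf. now right.
Qed.

Lemma is_RInt_line_mult_l k (f : R -> R) (l : R) :
  is_RInt_line f l -> is_RInt_line (fun s => k * f s) (k * l).
Proof. exact (is_RInt_gen_scal f k l). Qed.

Lemma is_RInt_line_shift (f : R -> R) (l t : R) :
  (forall s, continuous f s) -> is_RInt_line f l -> is_RInt_line (fun s => f (s + t)) l.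
Proof.
  intros Hf Hl.
  assert (Hft : forall s, continuous (fun s => f (s + t)) s).
  { intros s. apply (continuous_comp (fun s => s + t) f); [|apply Hf].
    now continuous_by_derive. }
  apply (is_RInt_line_filterlim f l Hf) in Hl.
  apply (is_RInt_line_filterlim _ l Hft).
  apply (filterlim_ext (fun ab => RInt f (fst ab + t) (snd ab + t))).
  { intros [a b]. simpl.
    rewrite <- (RInt_comp f (fun s => s + t) (fun _ => 1)).
    - apply RInt_ext. intros s _. apply Rmult_1_l.
    - auto.
    - intros s _. split; [auto_derive; [auto|ring]|apply continuous_const]. }
  apply (filterlim_comp _ _ _ (fun ab => (fst ab + t, snd ab + t))
    (fun ab => RInt f (fst ab) (snd ab)) _
    (filter_prod (Rbar_locally m_infty) (Rbar_locally p_infty))); [|exact Hl].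
  intros P [Qa Qb [Ma HMa] [Mb HMb] HQ].
  apply Filter_prod with (fun a => a < Ma - t) (fun b => Mb - t < b).
  - now exists (Ma - t).
  - now exists (Mb - t).
  - intros a b Ha Hb. apply HQ; [apply HMa|apply HMb]; simpl; lra.
Qed.

Lemma is_RInt_line_even (f : R -> R) (l : R) :
  (forall s, f (- s) = f s) ->
  is_RInt_gen f (at_point 0) (Rbar_locally p_infty) l -> is_RInt_line f (2 * l).
Proof.
  intros Heven Hl. replace (2 * l) with (plus l l) by (unfold plus; simpl; ring).
  apply (is_RInt_gen_Chasles f 0); [|exact Hl].
  intros P HP. destruct (Hl P HP) as [Qa Qb HQa [M HM] HQ].
  apply Filter_prod with (fun a => a < - M) (fun b => b = 0); [now exists (- M)|reflexivity|].
  intros a b Ha ->. destruct (HQ 0 (- a) HQa (HM (- a) ltac:(lra))) as (y & Hy & Py).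
  exists y. split; [|exact Py]. simpl in *.
  rewrite <- (opp_opp y). apply (is_RInt_swap f).
  apply (is_RInt_ext (fun s => opp (opp (f (- s))))); [intros s _; now rewrite opp_opp, Heven|].
  apply (is_RInt_opp (V := R_NormedModule)), (is_RInt_comp_opp (V := R_NormedModule)).
  now rewrite Ropp_0.
Qed.

Lemma Rabs_RInt_le_line (f g : R -> R) (c a b : R) :
  (forall s, continuous f s) -> (forall s, continuous g s) ->
  (forall s, Rabs (f s) <= g s) -> is_RInt_line g c -> a <= b -> Rabs (RInt f a b) <= c.
Proof.
  intros Hf Hg Hfg Hc Hab. apply (is_RInt_line_filterlim g c Hg) in Hc.
  assert (Hg0 : forall u v, u <= v -> 0 <= RInt g u v).
  { intros u v Huv. apply RInt_ge_0; [exact Huv|now apply ex_RInt_continuous_everywhere|].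
    intros s _. eapply Rle_trans; [apply Rabs_pos|apply Hfg]. }
  apply (filterlim_le (F := filter_prod (Rbar_locally m_infty) (Rbar_locally p_infty))
    (fun _ => Rabs (RInt f a b)) (fun uv => RInt g (fst uv) (snd uv)) (Rabs (RInt f a b)) c);
    [|apply filterlim_const|exact Hc].
  generalize (filter_line_covers a b). apply filter_imp. intros [u v] [Hu Hv]. simpl in *.
  rewrite <- (RInt_Chasles_continuous g u b v), <- (RInt_Chasles_continuous g u a b) by exact Hg.
  assert (Hfgab := Rabs_RInt_le f g a b Hf Hg Hfg).
  rewrite (Rabs_pos_eq (RInt g a b)) in Hfgab by auto.
  generalize (Hg0 u a Hu) (Hg0 b v Hv). lra.
Qed.

Lemma is_RInt_line_dominated (F : R -> R) (Fn g : nat -> R -> R) (ln c : nat -> R) (l : R) :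
  (forall s, continuous F s) -> (forall n s, continuous (Fn n) s) ->
  (forall n s, continuous (g n) s) ->
  (forall n s, Rabs (F s - Fn n s) <= g n s) ->
  (forall n, is_RInt_line (Fn n) (ln n)) -> (forall n, is_RInt_line (g n) (c n)) ->
  is_lim_seq ln l -> is_lim_seq c 0 ->
  is_RInt_line F l.
Proof.
  intros CF CFn Cg Hg HFn Hc Hl Hc0.
  apply (is_RInt_line_filterlim F l CF).
  apply filterlim_locally. intros [eps Heps].
  apply is_lim_seq_Reals in Hl, Hc0.
  destruct (Hl (eps / 3)) as [N1 HN1]; [lra|]. destruct (Hc0 (eps / 3)) as [N2 HN2]; [lra|].
  set (n := Nat.max N1 N2).
  specialize (HN1 n ltac:(unfold n; lia)). specialize (HN2 n ltac:(unfold n; lia)).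
  unfold Rdist in HN1, HN2. rewrite Rminus_0_r in HN2.
  specialize (HFn n). apply (is_RInt_line_filterlim _ _ (CFn n)) in HFn.
  assert (Heps3 : 0 < eps / 3) by lra.
  generalize (proj1 (filterlim_locally _ _) HFn (mkposreal _ Heps3)). intros Hball.
  generalize (filter_and _ _ Hball filter_line_le). apply filter_imp.
  intros [a b] [Hab Hle]. simpl in Hle.
  change (Rabs (RInt (Fn n) a b - ln n) < eps / 3) in Hab.
  change (Rabs (RInt F a b - l) < eps).
  assert (Hdiff : Rabs (RInt F a b - RInt (Fn n) a b) <= c n).
  { assert (Cd : forall s, continuous (fun s => F s - Fn n s) s)
      by (intros s; apply (continuous_minus F (Fn n)); auto).
    rewrite <- (RInt_minus F (Fn n)) by now apply ex_RInt_continuous_everywhere.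
    apply (Rabs_RInt_le_line _ (g n)); auto. }
  apply Rabs_def2 in Hab, HN1, HN2. apply Rabs_le_between in Hdiff. apply Rabs_def1; lra.
Qed.

Lemma is_RInt_line_series (f : nat -> R -> R) (F g : R -> R) (c b : nat -> R) (B I l : R) :
  (forall n s, continuous (f n) s) -> (forall s, continuous F s) -> (forall s, continuous g s) ->
  (forall s, is_series (fun n => f n s) (F s)) ->
  (forall n s, Rabs (f n s) <= b n * g s) -> is_series b B -> is_RInt_line g I ->
  (forall n, is_RInt_line (f n) (c n)) -> is_series c l ->
  is_RInt_line F l.
Proof.
  intros Cf CF Cg HF Hfb HB HI Hc Hl.
  apply (is_RInt_line_dominated F (fun n s => rsum (fun k => f k s) (seq 0 n))
    (fun n s => (B - rsum b (seq 0 n)) * g s)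
    (fun n => rsum c (seq 0 n)) (fun n => (B - rsum b (seq 0 n)) * I)).
  - exact CF.
  - intros n s. apply (continuous_rsum f). auto.
  - intros n s. apply (continuous_scal_r (V := R_NormedModule) _ g). auto.
  - intros n s. rewrite Rmult_minus_distr_r, <- rsum_mult_r.
    apply (Rabs_series_remainder_dominated (fun k => f k s) (fun k => b k * g s)); auto.
    now apply is_series_scal_r.
  - intros n. apply is_RInt_line_rsum. auto.
  - intros n. now apply is_RInt_line_mult_l.
  - now apply is_series_rsum.
  - replace (Finite 0) with (Rbar_mult 0 I) by (simpl; f_equal; ring).
    now apply (is_lim_seq_scal_r _ I 0), is_lim_seq_series_remainder.
Qed.

Lemma is_RInt_line_dirichlet (w : nat -> R) C (f : nat -> R -> R) (c : nat -> R) (F : R -> R)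
    (l : R) :
  (forall n, Rabs (rsum w (seq 0 n)) <= C) ->
  (forall n s, continuous (f n) s) -> (forall s, continuous F s) ->
  (forall n s, 0 <= f n s) -> (forall n s, f (S n) s <= f n s) ->
  (forall n, is_RInt_line (f n) (c n)) -> is_lim_seq c 0 ->
  (forall s, is_series (fun n => w n * f n s) (F s)) -> is_series (fun n => w n * c n) l ->
  is_RInt_line F l.
Proof.
  intros HC Cf CF Hf0 Hdecr Hc Hc0 HF Hl.
  apply (is_RInt_line_dominated F (fun n s => rsum (fun k => w k * f k s) (seq 0 n))
    (fun n s => 2 * C * f n s)
    (fun n => rsum (fun k => w k * c k) (seq 0 n)) (fun n => 2 * C * c n)).
  - exact CF.
  - intros n s. apply (continuous_rsum (fun k s => w k * f k s)). intros k _.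
    now apply (continuous_scal_r (V := R_NormedModule) _ (f k)).
  - intros n s. now apply (continuous_scal_r (V := R_NormedModule) _ (f n)).
  - intros n s. apply (Rabs_dirichlet_remainder_le w (fun k => f k s)); auto.
  - intros n. apply (is_RInt_line_rsum (fun k s => w k * f k s)). intros k _.
    now apply is_RInt_line_mult_l.
  - intros n. now apply is_RInt_line_mult_l.
  - now apply is_series_rsum.
  - replace (Finite 0) with (Rbar_mult (2 * C) 0) by (simpl; f_equal; ring).
    now apply is_lim_seq_scal_l.
Qed.

Section TermwiseConvolution.

Variables (w : nat -> R) (x y : nat -> R -> R) (X Y g : R -> R).
Variables (a b : nat -> R) (c : nat -> nat -> R) (W I : R).
Hypothesis w_bounded : forall d, Rabs (w d) <= W.
Hypothesis x_continuous : forall d s, continuous (x d) s.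
Hypothesis y_continuous : forall m s, continuous (y m) s.
Hypothesis X_continuous : forall s, continuous X s.
Hypothesis Y_continuous : forall s, continuous Y s.
Hypothesis g_continuous : forall s, continuous g s.
Hypothesis x_ge_0 : forall d s, 0 <= x d s.
Hypothesis y_ge_0 : forall m s, 0 <= y m s.
Hypothesis x_summable : forall s, ex_series (fun n => x (S n) s).
Hypothesis X_series : forall s, is_series (fun n => w (S n) * x (S n) s) (X s).
Hypothesis Y_series : forall s, is_series (fun n => y (S n) s) (Y s).
Hypothesis a_ge_0 : forall n, 0 <= a (S n).
Hypothesis a_summable : ex_series (fun n => a (S n)).
Hypothesis b_summable : ex_series (fun n => b (S n)).
Hypothesis g_integral : is_RInt_line g I.
Hypothesis xy_dominated :
  forall d m s, (1 <= d)%nat -> (1 <= m)%nat -> x d s * y m s <= a d * b m * g s.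
Hypothesis xy_integral :
  forall d m, (1 <= d)%nat -> (1 <= m)%nat -> is_RInt_line (fun s => x d s * y m s) (c d m).

Let f (n : nat) (s : R) : R := dirichlet_conv (fun d => w d * x d s) (fun m => y m s) (S n).
Let M (n : nat) : R := W * dirichlet_conv a b (S n).
Let integral_f (n : nat) : R :=
  rsum (fun d => w d * c d (S n / d)%nat) (divisors (S n)).

Lemma ex_series_dirichlet_conv_majorant : ex_series M.
Proof.
  destruct a_summable as [A HA], b_summable as [B HB].
  apply (ex_series_scal_l W (fun n => dirichlet_conv a b (S n))).
  exists (A * B). apply is_series_dirichlet_conv; auto.
  apply ex_series_ext with (2 := a_summable). intros n. symmetry. now apply Rabs_pos_eq.
Qed.

Lemma Rabs_dirichlet_conv_le_majorant n s : Rabs (f n s) <= M n * g s.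
Proof.
  unfold f, M, dirichlet_conv. eapply Rle_trans; [apply Rabs_rsum_le|].
  rewrite <- rsum_mult_l, <- rsum_mult_r. apply rsum_le. intros d Hd.
  apply in_divisors in Hd. rewrite Rmult_assoc, Rabs_mult.
  rewrite (Rabs_pos_eq (_ * _)) by now apply Rmult_le_pos.
  rewrite (Rmult_assoc W). apply Rmult_le_compat; [apply Rabs_pos|now apply Rmult_le_pos| |];
    [apply w_bounded|now apply xy_dominated].
Qed.

Lemma is_RInt_line_dirichlet_conv_term n : is_RInt_line (f n) (integral_f n).
Proof.
  apply (is_RInt_line_rsum (fun d s => w d * x d s * y (S n / d)%nat s)).
  intros d Hd. apply in_divisors in Hd.
  apply (is_RInt_line_ext (fun s => w d * (x d s * y (S n / d)%nat s)));
    [intros s; ring|]. now apply is_RInt_line_mult_l, xy_integral.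
Qed.

Lemma is_RInt_line_dirichlet_conv :
  exists l,
    is_series (fun n => rsum (fun d => w d * c d (S n / d)%nat) (divisors (S n))) l /\
    is_RInt_line (fun s => X s * Y s) l.
Proof.
  destruct ex_series_dirichlet_conv_majorant as [B HB].
  assert (Hex : ex_series integral_f).
  { apply (ex_series_le (V := R_CompleteNormedModule) _ (fun n => M n * I)).
    - intros n. apply (is_RInt_line_le (f n) (fun s => M n * g s)).
      + apply Rabs_dirichlet_conv_le_majorant.
      + apply is_RInt_line_dirichlet_conv_term.
      + now apply is_RInt_line_mult_l.
    - apply ex_series_scal_r. now exists B. }
  destruct Hex as [l Hl]. exists l. split; [exact Hl|].
  apply (is_RInt_line_series f _ g integral_f M B I);
    auto using Rabs_dirichlet_conv_le_majorant, is_RInt_line_dirichlet_conv_term.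
  - intros n s. apply (continuous_rsum (fun d s => w d * x d s * y (S n / d)%nat s)). intros d _.
    apply (continuous_mult (K := R_AbsRing) (fun s => w d * x d s)); [|apply y_continuous].
    apply (continuous_scal_r (V := R_NormedModule)), x_continuous.
  - intros s. now apply (continuous_mult (K := R_AbsRing) X).
  - intros s. apply is_series_dirichlet_conv; auto.
    apply (ex_series_Rabs_bounded_mult (fun n => w (S n)) (fun n => x (S n) s) W); auto.
Qed.

End TermwiseConvolution.

(** * Exponential and hyperbolic functions *)

Lemma exp_mult_exp_opp s : exp s * exp (- s) = 1.
Proof. rewrite <- exp_plus, Rplus_opp_r. apply exp_0. Qed.

Lemma exp_gt_1 x : 0 < x -> 1 < exp x.
Proof. intros Hx. rewrite <- exp_0. now apply exp_increasing. Qed.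

Lemma exp_le_compat x y : x <= y -> exp x <= exp y.
Proof. intros [H| ->]; [left; now apply exp_increasing|apply Rle_refl]. Qed.

Lemma exp_opp_le_inv x : 0 < x -> exp (- x) <= / x.
Proof.
  intros Hx. rewrite exp_Ropp. apply Rinv_le_contravar; [exact Hx|].
  generalize (exp_ineq1_le x). lra.
Qed.

Lemma exp_opp_pow x n : exp (- (INR n * x)) = exp (- x) ^ n.
Proof.
  induction n as [|n IH]; [simpl; rewrite Rmult_0_l, Ropp_0; apply exp_0|].
  rewrite S_INR. replace (- ((INR n + 1) * x)) with (- x + - (INR n * x)) by ring.
  now rewrite exp_plus, IH.
Qed.

Lemma le_of_derive_ge_0 (f df : R -> R) a b : a <= b ->
  (forall s, is_derive f s (df s)) -> (forall s, a <= s <= b -> 0 <= df s) -> f a <= f b.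
Proof.
  intros Hab Hf Hdf. destruct (MVT_gen f a b df) as (c & Hc & E).
  - intros s _. apply Hf.
  - intros s _. apply continuity_pt_filterlim.
    apply (ex_derive_continuous f). eexists. apply Hf.
  - rewrite Rmin_left, Rmax_right in Hc by lra. specialize (Hdf c Hc). nra.
Qed.

Lemma cosh_opp s : cosh (- s) = cosh s.
Proof. unfold cosh. rewrite Ropp_involutive. f_equal. ring. Qed.

Lemma sinh_double s : sinh (2 * s) = 2 * sinh s * cosh s.
Proof.
  unfold sinh, cosh. replace (- (2 * s)) with (- s + - s) by ring.
  replace (2 * s) with (s + s) by ring. rewrite !exp_plus. field.
Qed.

Lemma cosh_double s : cosh (2 * s) = 1 + 2 * sinh s ^ 2.
Proof.
  unfold sinh, cosh. replace (- (2 * s)) with (- s + - s) by ring.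
  replace (2 * s) with (s + s) by ring. rewrite !exp_plus.
  generalize (exp_mult_exp_opp s). nra.
Qed.

Lemma cosh_sqr s : cosh s ^ 2 = 1 + sinh s ^ 2.
Proof. unfold sinh, cosh. generalize (exp_mult_exp_opp s). nra. Qed.

Lemma cosh_ge_1 s : 1 <= cosh s.
Proof.
  replace s with (2 * (s / 2)) by field. rewrite cosh_double.
  generalize (pow2_ge_0 (sinh (s / 2))). lra.
Qed.

Lemma sinh_ge_id y : 0 <= y -> y <= sinh y.
Proof.
  intros Hy.
  assert (Hmono := le_of_derive_ge_0 (fun s => sinh s - s) (fun s => cosh s - 1) 0 y Hy).
  cbv beta in Hmono. rewrite sinh_0 in Hmono. enough (0 - 0 <= sinh y - y) by lra. apply Hmono.
  - intros s. auto_derive; [auto|ring].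
  - intros s _. generalize (cosh_ge_1 s). lra.
Qed.

Lemma sinh_ge_0 y : 0 <= y -> 0 <= sinh y.
Proof. intros Hy. generalize (sinh_ge_id y Hy). lra. Qed.

Lemma sinh_le_mult_cosh y : 0 <= y -> sinh y <= y * cosh y.
Proof.
  intros Hy.
  assert (Hmono := le_of_derive_ge_0 (fun s => s * cosh s - sinh s) (fun s => s * sinh s) 0 y Hy).
  cbv beta in Hmono. rewrite sinh_0 in Hmono.
  enough (0 * cosh 0 - 0 <= y * cosh y - sinh y) by lra. apply Hmono.
  - intros s. auto_derive; [auto|ring].
  - intros s Hs. apply Rmult_le_pos; [lra|apply sinh_ge_0; lra].
Qed.

Lemma cosh_increasing x y : 0 <= x <= y -> cosh x <= cosh y.
Proof.
  intros [Hx Hxy]. apply (le_of_derive_ge_0 cosh sinh x y Hxy).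
  - intros s. auto_derive; [auto|ring].
  - intros s Hs. apply sinh_ge_0. lra.
Qed.

Lemma cosh_half_le s : cosh (s / 2) <= cosh s.
Proof.
  replace s with (2 * (s / 2)) at 2 by field.
  rewrite cosh_double. generalize (cosh_sqr (s / 2)) (cosh_ge_1 (s / 2)). nra.
Qed.

Lemma cosh_ge_quadratic y : 1 + y ^ 2 / 2 <= cosh y.
Proof.
  replace y with (2 * (y / 2)) at 2 by field. rewrite cosh_double.
  enough ((y / 2) ^ 2 <= sinh (y / 2) ^ 2) by lra.
  assert (Hsq : forall x, 0 <= x -> x ^ 2 <= sinh x ^ 2)
    by (intros x Hx; apply pow_incr; generalize (sinh_ge_id x Hx); lra).
  destruct (Rle_dec 0 y) as [Hy|Hy]; [apply Hsq; lra|].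
  replace (sinh (y / 2)) with (- sinh (- (y / 2)))
    by (unfold sinh; rewrite Ropp_involutive; field).
  replace ((y / 2) ^ 2) with ((- (y / 2)) ^ 2) by ring.
  replace ((- sinh (- (y / 2))) ^ 2) with (sinh (- (y / 2)) ^ 2) by ring. apply Hsq. lra.
Qed.

(** * Explicit integrals over the line *)

Lemma is_lim_mult_id_m_infty c : 0 < c -> is_lim (fun s => c * s) m_infty m_infty.
Proof.
  intros Hc. assert (L := is_lim_scal_l (fun s => s) c m_infty m_infty (is_lim_id m_infty)).
  now rewrite (is_Rbar_mult_unique _ _ _
    (is_Rbar_mult_sym _ _ _ (is_Rbar_mult_m_infty_pos c Hc))) in L.
Qed.

Lemma is_lim_comp_exp_m_infty (h : R -> R) c :
  0 < c -> continuous h 0 -> is_lim (fun s => h (exp (c * s))) m_infty (h 0).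
Proof.
  intros Hc Hh. apply (is_lim_comp_continuous (fun s => exp (c * s)) h m_infty 0); [|exact Hh].
  apply (is_lim_comp exp (fun s => c * s) m_infty 0 m_infty).
  - apply is_lim_exp_m.
  - now apply is_lim_mult_id_m_infty.
  - now exists 0.
Qed.

Lemma is_lim_comp_exp_p_infty (h : R -> R) c :
  0 < c -> continuous h 0 -> is_lim (fun s => h (exp (- (c * s)))) p_infty (h 0).
Proof.
  intros Hc Hh.
  apply (is_lim_ext (fun s => (fun t => h (exp (c * t))) (- s)));
    [intros s; f_equal; f_equal; ring|].
  apply (is_lim_comp (fun t => h (exp (c * t))) (fun s => - s) p_infty (h 0) m_infty).
  - now apply is_lim_comp_exp_m_infty.
  - apply (is_lim_opp (fun s => s) p_infty p_infty), is_lim_id.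
  - now exists 0.
Qed.

Lemma is_lim_atan_exp_m_infty k c : 0 < c -> is_lim (fun s => atan (k * exp (c * s))) m_infty 0.
Proof.
  intros Hc. replace 0 with (atan (k * 0)) by (rewrite Rmult_0_r; apply atan_0).
  apply (is_lim_comp_exp_m_infty (fun E => atan (k * E))); [exact Hc|].
  now continuous_by_derive.
Qed.

Lemma is_lim_atan_exp_p_infty k c : 0 < k -> 0 < c ->
  is_lim (fun s => atan (k * exp (c * s))) p_infty (PI / 2).
Proof.
  intros Hk Hc.
  apply (is_lim_ext (fun s => PI / 2 - atan (/ k * exp (- (c * s))))).
  { intros s. rewrite exp_Ropp, <- Rinv_mult, atan_inv; [lra|].
    apply Rmult_lt_0_compat; [exact Hk|apply exp_pos]. }
  assert (L := is_lim_comp_exp_p_infty (fun E => PI / 2 - atan (/ k * E)) c Hc).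
  cbv beta in L. rewrite Rmult_0_r, atan_0, Rminus_0_r in L. apply L.
  now continuous_by_derive.
Qed.

Lemma continuous_sech_half s : continuous (fun s => / cosh (s / 2)) s.
Proof.
  continuous_by_derive.
  generalize (cosh_ge_1 (s / 2)). unfold Rdiv. lra.
Qed.

Lemma is_RInt_gen_sech_half :
  is_RInt_gen (fun s => / cosh (s / 2)) (at_point 0) (Rbar_locally p_infty) PI.
Proof.
  assert (E0 : 4 * atan (1 * exp (/ 2 * 0)) = PI)
    by (rewrite Rmult_0_r, exp_0, Rmult_1_l, atan_1; field).
  replace PI with (4 * (PI / 2) - 4 * atan (1 * exp (/ 2 * 0))) by (rewrite E0; field).
  apply (is_RInt_gen_antiderivative (fun s => 4 * atan (1 * exp (/ 2 * s))) _
    (at_point 0) (Rbar_locally p_infty)).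
  - intros s. auto_derive; [auto|]. unfold cosh, Rsqr.
    replace (- (s / 2)) with (- (/ 2 * s)) by field. replace (s / 2) with (/ 2 * s) by field.
    rewrite exp_Ropp. assert (He := exp_pos (/ 2 * s)).
    field. repeat split; apply Rgt_not_eq; nra.
  - apply continuous_sech_half.
  - intros P HP. exact (locally_singleton _ _ HP).
  - apply (is_lim_scal_l _ 4 p_infty (PI / 2)), is_lim_atan_exp_p_infty; lra.
Qed.

Lemma is_RInt_line_sech_half : is_RInt_line (fun s => / cosh (s / 2)) (2 * PI).
Proof.
  apply is_RInt_line_even; [|apply is_RInt_gen_sech_half].
  intros s. rewrite <- (cosh_opp (s / 2)). do 2 f_equal. field.
Qed.

Lemma continuous_exp_cosh y s : continuous (fun s => exp (- y * cosh s)) s.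
Proof. now continuous_by_derive. Qed.

Lemma is_RInt_gen_K0 y : 0 < y ->
  is_RInt_gen (fun s => exp (- y * cosh s)) (at_point 0) (Rbar_locally p_infty) (K0 y).
Proof.
  intros Hy. apply (RInt_gen_correct (V := R_CompleteNormedModule)).
  apply (ex_RInt_gen_dominated _ (fun s => / y * / cosh (s / 2))
    (at_point 0) (Rbar_locally p_infty)).
  - apply continuous_exp_cosh.
  - intros s. apply (continuous_scal_r (V := R_NormedModule)), continuous_sech_half.
  - intros s. rewrite Rabs_pos_eq by (left; apply exp_pos).
    assert (Hcosh := cosh_ge_1 (s / 2)). assert (Hhalf := cosh_half_le s).
    rewrite <- Ropp_mult_distr_l. eapply Rle_trans; [apply exp_opp_le_inv; nra|].
    rewrite <- Rinv_mult. apply Rinv_le_contravar; nra.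
  - exists (/ y * PI). apply (is_RInt_gen_scal (fun s => / cosh (s / 2)) (/ y)).
    apply is_RInt_gen_sech_half.
Qed.

Lemma is_RInt_line_K0 al d m : 0 < al -> 0 < d -> 0 < m ->
  is_RInt_line (fun s => exp (- (al * (d * exp s + m * exp (- s)))))
    (2 * K0 (2 * al * sqrt (d * m))).
Proof.
  intros Hal Hd Hm. rewrite sqrt_mult by lra.
  assert (Sd := sqrt_lt_R0 d Hd). assert (Ed := sqrt_sqrt d ltac:(lra)).
  assert (Sm := sqrt_lt_R0 m Hm). assert (Em := sqrt_sqrt m ltac:(lra)).
  set (y := 2 * al * (sqrt d * sqrt m)).
  assert (Hy : 0 < y) by (unfold y; repeat (apply Rmult_lt_0_compat || lra)).
  assert (Hline : is_RInt_line (fun s => exp (- y * cosh s)) (2 * K0 y)).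
  { apply is_RInt_line_even; [|now apply is_RInt_gen_K0]. intros s. now rewrite cosh_opp. }
  apply (is_RInt_line_shift _ _ (ln (sqrt d / sqrt m)) (continuous_exp_cosh y)) in Hline.
  revert Hline. apply is_RInt_line_ext. intros s. f_equal. unfold cosh.
  rewrite Ropp_plus_distr, !exp_plus, (exp_Ropp (ln _)), exp_ln by now apply Rdiv_lt_0_compat.
  unfold y. set (D := sqrt d) in *. set (M := sqrt m) in *. rewrite <- Ed, <- Em. field. lra.
Qed.

Lemma is_RInt_line_exp_neg_exp k : 0 < k ->
  is_RInt_line (fun s => exp (- (k * exp s)) * exp s) (/ k).
Proof.
  intros Hk. replace (/ k) with (- / k * 0 - - / k * exp (- (k * 0)))
    by (rewrite (Rmult_0_r k), Ropp_0, exp_0; ring).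
  apply (is_RInt_gen_antiderivative (fun s => - / k * exp (- (k * exp s))) _
    (Rbar_locally m_infty) (Rbar_locally p_infty)).
  - intros s. auto_derive; [auto|]. field. lra.
  - intros s. now continuous_by_derive.
  - assert (L := is_lim_comp_exp_m_infty (fun E => - / k * exp (- (k * E))) 1 Rlt_0_1).
    refine (is_lim_ext _ _ _ _ _ (L _)); [intros s; now rewrite Rmult_1_l|].
    now continuous_by_derive.
  - apply (is_lim_scal_l _ (- / k) p_infty 0).
    apply (is_lim_le_le_loc (fun _ => 0) (fun s => / k * exp (- (1 * s))) _ p_infty 0).
    + exists 0. intros s _. split; [left; apply exp_pos|].
      rewrite Rmult_1_l, (exp_Ropp s), <- Rinv_mult. apply exp_opp_le_inv.
      apply Rmult_lt_0_compat; [exact Hk|apply exp_pos].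
    + apply is_lim_const.
    + assert (L := is_lim_comp_exp_p_infty (fun E => / k * E) 1 Rlt_0_1).
      cbv beta in L. rewrite Rmult_0_r in L. apply L.
      now continuous_by_derive.
Qed.

Lemma is_RInt_line_log A B C : 0 < A -> 0 < B -> 0 < C -> A ^ 2 <> B * C ->
  is_RInt_line (fun s => / ((A * exp (2 * s) + B) * (A * exp (- (2 * s)) + C)))
    (ln (A ^ 2 / (B * C)) / (2 * (A ^ 2 - B * C))).
Proof.
  intros HA HB HC Hne. set (k := 2 * (A ^ 2 - B * C)).
  assert (Hk : k <> 0) by (unfold k; lra).
  assert (HAC : 0 < A / C) by now apply Rdiv_lt_0_compat.
  assert (HBA : 0 < B / A) by now apply Rdiv_lt_0_compat.
  replace (A ^ 2 / (B * C)) with (A / C / (B / A)) by (field; lra).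
  rewrite (ln_div (A / C) (B / A)) by assumption.
  replace ((ln (A / C) - ln (B / A)) / k) with (ln (A / C) / k - ln (B / A) / k)
    by (field; exact Hk).
  set (G := fun s => ln ((A * exp (2 * s) + B) / (A + C * exp (2 * s))) / k).
  apply (is_RInt_gen_antiderivative G _ (Rbar_locally m_infty) (Rbar_locally p_infty)).
  - intros s. assert (HE := exp_pos (2 * s)).
    assert (HAE : 0 < A * exp (2 * s)) by now apply Rmult_lt_0_compat.
    assert (HCE : 0 < C * exp (2 * s)) by now apply Rmult_lt_0_compat.
    unfold G. auto_derive.
    + repeat split; try lra. apply Rdiv_lt_0_compat; lra.
    + rewrite exp_Ropp. unfold k in *. field. repeat split; try lra; apply Rgt_not_eq; nra.
  - intros s. assert (HE := exp_pos (2 * s)). assert (HE' := exp_pos (- (2 * s))).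
    continuous_by_derive. apply Rgt_not_eq. apply Rmult_lt_0_compat; nra.
  - assert (L := is_lim_comp_exp_m_infty (fun E => ln ((A * E + B) / (A + C * E)) / k) 2).
    cbv beta in L. rewrite !Rmult_0_r, Rplus_0_l, Rplus_0_r in L. apply L; [lra|].
    continuous_by_derive.
    rewrite !Rmult_0_r, Rplus_0_l, Rplus_0_r. repeat split; lra.
  - assert (L := is_lim_comp_exp_p_infty (fun E => ln ((A + B * E) / (A * E + C)) / k) 2).
    cbv beta in L. rewrite !Rmult_0_r, Rplus_0_l, Rplus_0_r in L.
    refine (is_lim_ext _ _ _ _ _ (L _ _)); [|lra|].
    { intros s. assert (HE := exp_pos (2 * s)). unfold G. rewrite exp_Ropp. do 2 f_equal.
      field. split; apply Rgt_not_eq; nra. }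
    continuous_by_derive.
    rewrite !Rmult_0_r, Rplus_0_l, Rplus_0_r. repeat split; lra.
Qed.

(** * Partial fractions of the Poisson kernel *)

Definition poisson (y th : R) : R := sinh y / (cosh y - cos th).

Definition lorentz (y t : R) : R := 2 * y / (y ^ 2 + t ^ 2).

Definition lorentz_pair (y th : R) (k : nat) : R :=
  lorentz y (th + 2 * PI * INR k) + lorentz y (th - 2 * PI * INR (S k)).

Lemma sqr_plus_sqr_pos y t : 0 < y -> 0 < y ^ 2 + t ^ 2.
Proof. intros Hy. generalize (pow_lt y 2 Hy) (pow2_ge_0 t). lra. Qed.

Lemma lorentz_ge_0 y t : 0 < y -> 0 <= lorentz y t.
Proof. intros Hy. left. apply Rdiv_lt_0_compat; [lra|now apply sqr_plus_sqr_pos]. Qed.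

Lemma lorentz_opp y t : lorentz y (- t) = lorentz y t.
Proof. unfold lorentz. f_equal. ring. Qed.

Lemma continuous_lorentz (g : R -> R) t s :
  continuous g s -> 0 < g s -> continuous (fun s => lorentz (g s) t) s.
Proof.
  intros Hg Hpos. apply (continuous_comp g (fun y => lorentz y t)); [exact Hg|].
  unfold lorentz. continuous_by_derive. generalize (sqr_plus_sqr_pos (g s) t Hpos). lra.
Qed.

Lemma lorentz_decreasing y s t : 0 < y -> 0 <= s <= t -> lorentz y t <= lorentz y s.
Proof.
  intros Hy Hst. apply Rmult_le_compat_l; [lra|].
  apply Rinv_le_contravar; [now apply sqr_plus_sqr_pos|]. nra.
Qed.

Lemma lorentz_scale c y t : 0 < c -> 0 < y -> / c * lorentz (y / c) (t / c) = lorentz y t.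
Proof.
  intros Hc Hy. unfold lorentz. assert (Hyt := sqr_plus_sqr_pos y t Hy). field. lra.
Qed.

Lemma ex_series_lorentz y b : 0 < y -> 0 < b -> ex_series (fun k => lorentz y (b * INR (S k))).
Proof.
  intros Hy Hb.
  apply (ex_series_le (V := R_CompleteNormedModule) _
    (fun k => 2 * y / b ^ 2 * inv_pow_3_2 (INR (S k)))).
  - intros k. assert (Hk : 1 <= INR (S k)) by (apply (le_INR 1); lia).
    assert (Hb2 := pow_lt b 2 Hb). set (n := INR (S k)) in *.
    assert (Hn2 : 0 < n ^ 2) by (apply pow_lt; lra).
    change (Rabs (lorentz y (b * n)) <= 2 * y / b ^ 2 * inv_pow_3_2 n).
    rewrite Rabs_pos_eq by now apply lorentz_ge_0.
    apply Rle_trans with (2 * y / b ^ 2 * / n ^ 2).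
    + replace (2 * y / b ^ 2 * / n ^ 2) with (2 * y * / (b * n) ^ 2) by (field; lra).
      apply Rmult_le_compat_l; [lra|]. apply Rinv_le_contravar; [nra|].
      generalize (pow2_ge_0 y). lra.
    + apply Rmult_le_compat_l; [left; apply Rdiv_lt_0_compat; lra|].
      now apply inv_sqr_le_inv_pow_3_2.
  - apply (ex_series_scal_l (2 * y / b ^ 2) (fun k => inv_pow_3_2 (INR (S k)))),
      ex_series_inv_pow_3_2.
Qed.

Lemma lorentz_pair_ge_0 y th k : 0 < y -> 0 <= lorentz_pair y th k.
Proof. intros Hy. apply Rplus_le_le_0_compat; now apply lorentz_ge_0. Qed.

Lemma ex_series_lorentz_pair y th : 0 < y -> 0 <= th <= 2 * PI -> ex_series (lorentz_pair y th).
Proof.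
  intros Hy Hth. assert (HPI := PI_RGT_0). apply ex_series_incr_1.
  apply (ex_series_le (V := R_CompleteNormedModule) _
    (fun k => 2 * lorentz y (2 * PI * INR (S k)))).
  - intros k. assert (Hk := pos_INR (S k)).
    change (Rabs (lorentz_pair y th (S k)) <= 2 * lorentz y (2 * PI * INR (S k))).
    rewrite Rabs_pos_eq by now apply lorentz_pair_ge_0.
    unfold lorentz_pair. rewrite <- (lorentz_opp y (th - _)), (S_INR (S k)).
    assert (Hfar := fun t => lorentz_decreasing y (2 * PI * INR (S k)) t Hy).
    generalize (Hfar (th + 2 * PI * INR (S k)) ltac:(nra)).
    generalize (Hfar (- (th - 2 * PI * (INR (S k) + 1))) ltac:(nra)). lra.
  - apply (ex_series_scal_l 2 (fun k => lorentz y (2 * PI * INR (S k)))), ex_series_lorentz; lra.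
Qed.

Lemma sin_cubic_lower x : 0 <= x <= PI / 2 -> x - x ^ 3 / 6 <= sin x.
Proof.
  intros Hx. assert (HPI4 := PI_4).
  destruct (SIN x) as [Hsin _]; [lra|lra|].
  eapply Rle_trans; [|exact Hsin].
  unfold sin_lb, sin_approx, sin_term; simpl. field_simplify.
  assert (Hx5 : 0 <= x ^ 5) by (apply pow_le; lra).
  assert (Hx7 : x ^ 7 <= 42 * x ^ 5).
  { replace (x ^ 7) with (x ^ 2 * x ^ 5) by ring. apply Rmult_le_compat_r; [exact Hx5|]. nra. }
  lra.
Qed.

Lemma one_minus_cos t : 1 - cos t = 2 * sin (t / 2) ^ 2.
Proof. replace t with (2 * (t / 2)) at 1 by field. rewrite cos_2a_sin. ring. Qed.

Lemma one_minus_cos_ge t : Rabs t <= PI -> t ^ 2 / 18 <= 1 - cos t.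
Proof.
  intros Ht. replace (cos t) with (cos (Rabs t))
    by (unfold Rabs; destruct (Rcase_abs t); [apply cos_neg|reflexivity]).
  rewrite <- pow2_abs, one_minus_cos. assert (Hu := Rabs_pos t). set (u := Rabs t) in *.
  assert (HPI4 := PI_4). assert (Hsin := sin_cubic_lower (u / 2) ltac:(lra)).
  assert (Hthird : u / 6 <= sin (u / 2)) by nra. nra.
Qed.

Lemma cosh_minus_cos_pos y th : 0 < y -> 0 < cosh y - cos th.
Proof. intros Hy. generalize (cosh_ge_quadratic y) (COS_bound th) (pow_lt y 2 Hy). lra. Qed.

Lemma cosh_minus_cos y th : cosh y - cos th = 2 * (sinh (y / 2) ^ 2 + sin (th / 2) ^ 2).
Proof.
  replace (cosh y) with (cosh (2 * (y / 2))) by (f_equal; field).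
  generalize (cosh_double (y / 2)) (one_minus_cos th). lra.
Qed.

Lemma poisson_ge_0 y th : 0 < y -> 0 <= poisson y th.
Proof.
  intros Hy. apply Rmult_le_pos; [apply sinh_ge_0; lra|].
  left. now apply Rinv_0_lt_compat, cosh_minus_cos_pos.
Qed.

Lemma poisson_le y t : 0 < y -> Rabs t <= PI -> poisson y t <= 9 * cosh y * lorentz y t.
Proof.
  intros Hy Ht. assert (Hyt := sqr_plus_sqr_pos y t Hy).
  assert (Hsinh := sinh_le_mult_cosh y ltac:(lra)). assert (Hsinh0 := sinh_ge_0 y ltac:(lra)).
  assert (Hden : (y ^ 2 + t ^ 2) / 18 <= cosh y - cos t)
    by (generalize (cosh_ge_quadratic y) (one_minus_cos_ge t Ht) (pow_lt y 2 Hy); lra).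
  replace (9 * cosh y * lorentz y t) with (y * cosh y * / ((y ^ 2 + t ^ 2) / 18))
    by (unfold lorentz; field; lra).
  apply Rmult_le_compat; [lra| |exact Hsinh|apply Rinv_le_contravar; lra].
  left. apply Rinv_0_lt_compat. lra.
Qed.

Lemma poisson_period y th : poisson y (th + 2 * PI) = poisson y th.
Proof.
  unfold poisson. now rewrite cos_plus, cos_2PI, sin_2PI, Rmult_0_r, Rmult_1_r, Rminus_0_r.
Qed.

Lemma poisson_dup y th : 0 < y ->
  poisson y th = / 2 * (poisson (y / 2) (th / 2) + poisson (y / 2) (th / 2 + PI)).
Proof.
  intros Hy. unfold poisson. rewrite neg_cos.
  assert (Esinh := sinh_double (y / 2)). assert (Ecosh := cosh_double (y / 2)).
  replace (2 * (y / 2)) with y in Esinh, Ecosh by field.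
  assert (Ecos : cos th = 2 * cos (th / 2) ^ 2 - 1).
  { replace th with (2 * (th / 2)) at 1 by field. rewrite cos_2a_cos. ring. }
  assert (Hsqr := cosh_sqr (y / 2)). assert (Hcos := COS_bound (th / 2)).
  assert (Hcosh : 1 < cosh (y / 2))
    by (generalize (cosh_ge_quadratic (y / 2)) (pow_lt (y / 2) 2 ltac:(lra)); lra).
  rewrite Esinh, Ecosh, Ecos.
  replace (1 + 2 * sinh (y / 2) ^ 2) with (2 * cosh (y / 2) ^ 2 - 1) by lra.
  field. repeat split; nra.
Qed.

Definition scaled_poisson (N y t : R) : R := / N * poisson (y / N) (t / N).

Lemma poisson_mult_pow2 y th n : 0 < y ->
  poisson y th = rsum (fun k => scaled_poisson (2 ^ n) y (th + 2 * PI * INR k)) (seq 0 (2 ^ n)).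
Proof.
  intros Hy. unfold scaled_poisson. induction n as [|n IH].
  - unfold lsum. simpl. rewrite Rmult_0_r, !Rdiv_1_r, Rinv_1, !Rplus_0_r. ring.
  - assert (HN : 0 < 2 ^ n) by (apply pow_lt; lra).
    assert (EN : INR (2 ^ n) = 2 ^ n) by (now rewrite pow_INR).
    replace (2 ^ S n)%nat with (2 ^ n + 2 ^ n)%nat by (simpl; lia).
    rewrite lsum_seq_split, Nat.add_comm, lsum_seq_shift, <- lsum_op, IH.
    apply lsum_ext. intros k _.
    rewrite poisson_dup by now apply Rdiv_lt_0_compat.
    rewrite plus_INR, EN, <- Rmult_plus_distr_l, <- Rmult_assoc.
    f_equal; [simpl; field; lra|]. f_equal; f_equal; simpl; field; lra.
Qed.

Lemma scaled_poisson_period N y t : N <> 0 ->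
  scaled_poisson N y (t + 2 * PI * N) = scaled_poisson N y t.
Proof.
  intros HN. unfold scaled_poisson. rewrite <- (poisson_period _ (t / N)). do 2 f_equal. field.
  exact HN.
Qed.

Lemma poisson_pairs y th n : 0 < y ->
  poisson y th =
  rsum (fun k => scaled_poisson (2 ^ S n) y (th + 2 * PI * INR k)
                 + scaled_poisson (2 ^ S n) y (th - 2 * PI * INR (S k))) (seq 0 (2 ^ n)).
Proof.
  intros Hy. rewrite (poisson_mult_pow2 y th (S n) Hy).
  replace (2 ^ S n)%nat with (2 ^ n + 2 ^ n)%nat by (simpl; lia).
  rewrite lsum_seq_split, (Nat.add_comm 0), lsum_seq_shift, lsum_op. f_equal.
  rewrite lsum_seq_rev. apply lsum_ext. intros k Hk. apply in_seq in Hk.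
  rewrite <- (scaled_poisson_period _ _ (th - _)) by (apply pow_nonzero; lra). f_equal.
  assert (EN : INR (2 ^ n) = 2 ^ n) by (now rewrite pow_INR).
  rewrite plus_INR, !minus_INR, (S_INR k), EN by lia. simpl. ring.
Qed.

Lemma is_lim_seq_slope_0 (g : R -> R) (c : R) (h : nat -> R) :
  g 0 = 0 -> is_derive g 0 1 -> (forall n, h n <> 0) -> is_lim_seq h 0 ->
  is_lim_seq (fun n => g (c * h n) / h n) c.
Proof.
  intros Hg0 Hg Hh Hh0.
  assert (Hgc : is_derive (fun e => g (c * e)) 0 c).
  { auto_derive; rewrite Rmult_0_r; [now exists 1|].
    change (c * 1 * Derive g 0 = c). rewrite (is_derive_unique g 0 1 Hg). ring. }
  apply is_derive_Reals in Hgc. apply is_lim_seq_Reals in Hh0.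
  apply is_lim_seq_Reals. intros eps Heps.
  destruct (Hgc eps Heps) as [delta Hdelta]. destruct (Hh0 delta (cond_pos delta)) as [N HN].
  exists N. intros n Hn. specialize (HN n Hn). unfold Rdist in *. rewrite Rminus_0_r in HN.
  specialize (Hdelta (h n) (Hh n) HN).
  now rewrite Rplus_0_l, Rmult_0_r, Hg0, Rminus_0_r in Hdelta.
Qed.

Lemma is_lim_seq_scaled_poisson (N : nat -> R) y t :
  0 < y -> (forall n, 0 < N n) -> is_lim_seq N p_infty ->
  is_lim_seq (fun n => scaled_poisson (N n) y t) (lorentz y t).
Proof.
  intros Hy HN HNlim. set (h := fun n => / N n).
  assert (Hh : forall n, 0 < h n) by (intros n; now apply Rinv_0_lt_compat).
  assert (Hne : forall n, h n <> 0) by (intros n; apply Rgt_not_eq, Hh).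
  assert (Hh0 : is_lim_seq h 0) by (apply (is_lim_seq_inv N p_infty); [exact HNlim|discriminate]).
  assert (Lsinh : forall c, is_lim_seq (fun n => sinh (c * h n) / h n) c).
  { intros c. apply (is_lim_seq_slope_0 sinh); auto using sinh_0.
    auto_derive; [auto|]. rewrite cosh_0. ring. }
  assert (Lsin : forall c, is_lim_seq (fun n => sin (c * h n) / h n) c).
  { intros c. apply (is_lim_seq_slope_0 sin); auto using sin_0.
    auto_derive; [auto|]. rewrite cos_0. ring. }
  assert (Hyt := sqr_plus_sqr_pos y t Hy).
  replace (lorentz y t) with (y / (2 * (y / 2 * (y / 2) + t / 2 * (t / 2))))
    by (unfold lorentz; field; lra).
  apply (is_lim_seq_ext (fun n => sinh (y * h n) / h n /
    (2 * (sinh (y / 2 * h n) / h n * (sinh (y / 2 * h n) / h n)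
          + sin (t / 2 * h n) / h n * (sin (t / 2 * h n) / h n))))).
  - intros n. assert (Hden := cosh_minus_cos_pos (y * h n) (t * h n)
      ltac:(now apply Rmult_lt_0_compat)).
    change (scaled_poisson (N n) y t)
      with (h n * (sinh (y * h n) / (cosh (y * h n) - cos (t * h n)))).
    rewrite cosh_minus_cos in *.
    replace (y * h n / 2) with (y / 2 * h n) in * by field.
    replace (t * h n / 2) with (t / 2 * h n) in * by field.
    field. split; [lra|apply Hne].
  - apply is_lim_seq_div'; [apply Lsinh| |lra].
    apply (is_lim_seq_scal_l _ 2 (Finite _)).
    apply is_lim_seq_plus'; now apply is_lim_seq_mult'.
Qed.

Lemma scaled_poisson_ge_0 N y t : 0 < y -> 0 < N -> 0 <= scaled_poisson N y t.
Proof.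
  intros Hy HN. apply Rmult_le_pos; [left; now apply Rinv_0_lt_compat|].
  now apply poisson_ge_0, Rdiv_lt_0_compat.
Qed.

Lemma scaled_poisson_le N y t : 0 < y -> 1 <= N -> Rabs t <= PI * N ->
  scaled_poisson N y t <= 9 * cosh y * lorentz y t.
Proof.
  intros Hy HN Ht. unfold scaled_poisson.
  assert (HyN : 0 < y / N <= y) by (split; [apply Rdiv_lt_0_compat|apply Rle_div_l]; nra).
  rewrite <- (lorentz_scale N y t), <- Rmult_assoc, (Rmult_comm _ (/ N)), Rmult_assoc by lra.
  apply Rmult_le_compat_l; [left; apply Rinv_0_lt_compat; lra|].
  eapply Rle_trans; [apply poisson_le; [lra|]|].
  - rewrite Rabs_div, (Rabs_pos_eq N) by lra. apply Rle_div_l; lra.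
  - apply Rmult_le_compat_r; [now apply lorentz_ge_0|].
    generalize (cosh_increasing (y / N) y ltac:(lra)). lra.
Qed.

(* Euler's method: let the number [2 ^ S n] of translates in [poisson_pairs] tend to infinity. *)
Lemma is_series_poisson y th : 0 < y -> 0 <= th <= 2 * PI ->
  is_series (lorentz_pair y th) (poisson y th).
Proof.
  intros Hy Hth. destruct (ex_series_lorentz_pair y th Hy Hth) as [l Hl].
  enough (L : is_lim_seq (fun _ => poisson y th) l).
  { apply is_lim_seq_unique in L. rewrite Lim_seq_const in L. injection L as ->. exact Hl. }
  apply (is_lim_seq_ext _ _ _ (fun n => eq_sym (poisson_pairs y th n Hy))).
  assert (Hpow : forall n, 1 <= 2 ^ S n) by (intros n; apply pow_R1_Rle; lra).
  assert (Hpow0 : forall n, 0 < 2 ^ S n) by (intros n; apply pow_lt; lra).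
  apply (is_lim_seq_rsum_dominated (fun n k =>
      scaled_poisson (2 ^ S n) y (th + 2 * PI * INR k)
      + scaled_poisson (2 ^ S n) y (th - 2 * PI * INR (S k)))
    (lorentz_pair y th) (fun k => 9 * cosh y * lorentz_pair y th k));
    [| |apply (ex_series_scal_l (9 * cosh y) (lorentz_pair y th)); now exists l| |exact Hl].
  - intros P [N HN]. exists N. intros n Hn. apply HN. generalize (Nat.pow_gt_lin_r 2 n). lia.
  - intros n k Hk. assert (Hk0 := pos_INR k).
    rewrite Rabs_pos_eq by (apply Rplus_le_le_0_compat; now apply scaled_poisson_ge_0).
    assert (Hk' : 2 * PI * INR (S k) <= PI * 2 ^ S n).
    { replace (PI * 2 ^ S n) with (2 * PI * 2 ^ n) by (simpl; ring).
      apply Rmult_le_compat_l; [lra|]. rewrite <- (pow_INR 2). apply le_INR. lia. }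
    unfold lorentz_pair. rewrite Rmult_plus_distr_l. rewrite S_INR in *.
    apply Rplus_le_compat; apply scaled_poisson_le; auto; apply Rabs_le; nra.
  - intros k. apply is_lim_seq_plus'; apply is_lim_seq_scaled_poisson; auto;
      apply (is_lim_seq_incr_1 (fun n => 2 ^ n)), is_lim_seq_geom_p; lra.
Qed.

Lemma is_series_bose w : 0 < w ->
  is_series (fun k => lorentz w (2 * PI * INR (S k))) (/ (exp w - 1) - / w + / 2).
Proof.
  intros Hw. assert (HPI := PI_RGT_0).
  set (f := fun k => lorentz w (2 * PI * INR k)).
  assert (Epair : forall k, lorentz_pair w 0 k = f k + f (S k)).
  { intros k. unfold lorentz_pair, f. rewrite Rplus_0_l, Rminus_0_l, lorentz_opp. reflexivity. }
  assert (Hpair := is_series_poisson w 0 Hw ltac:(lra)).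
  assert (Hf : ex_series (fun k => f (S k))) by (apply ex_series_lorentz; lra).
  assert (Esum : poisson w 0 = 2 / w + 2 * Series (fun k => f (S k))).
  { rewrite <- (is_series_unique _ _ Hpair), (Series_ext _ _ Epair), Series_plus
      by (exact Hf || now apply ex_series_incr_1).
    rewrite (Series_incr_1 f) by now apply ex_series_incr_1.
    replace (f O) with (2 / w) by (unfold f, lorentz; simpl; field; lra). ring. }
  replace (/ (exp w - 1) - / w + / 2) with (Series (fun k => f (S k)));
    [now apply Series_correct|].
  assert (Hew := exp_gt_1 w Hw).
  replace (Series (fun k => f (S k))) with ((poisson w 0 - 2 / w) / 2) by lra.
  unfold poisson, sinh, cosh. rewrite cos_0, exp_Ropp.
  assert (0 < (exp w - 1) * (exp w - 1)) by (apply Rmult_lt_0_compat; lra).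
  field. repeat split; lra.
Qed.

(** * Geometric series of cosines *)

Lemma rsum_cos_pow r th n :
  (1 - 2 * r * cos th + r ^ 2) * rsum (fun k => r ^ S k * cos (INR (S k) * th)) (seq 0 n)
  = r * cos th - r ^ 2 + r ^ S n * (r * cos (INR n * th) - cos (INR (S n) * th)).
Proof.
  induction n as [|n IH].
  - unfold lsum. simpl. rewrite Rmult_0_l, cos_0, Rmult_1_l. ring.
  - rewrite lsum_seq_S, Rmult_plus_distr_l, IH, Nat.add_0_l.
    assert (Erec : cos (INR (S (S n)) * th)
        = 2 * cos th * cos (INR (S n) * th) - cos (INR n * th)).
    { replace (INR (S (S n)) * th) with (INR (S n) * th + th) by (rewrite (S_INR (S n)); ring).
      replace (INR n * th) with (INR (S n) * th - th) by (rewrite S_INR; ring).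
      rewrite cos_plus, cos_minus. ring. }
    rewrite Erec. simpl. ring.
Qed.

Lemma Rabs_rsum_cos_le th n : cos th < 1 ->
  Rabs (rsum (fun k => cos (INR (S k) * th)) (seq 0 n)) <= 2 / (1 - cos th).
Proof.
  intros Hth. assert (E := rsum_cos_pow 1 th n).
  rewrite (lsum_ext _ (fun k => cos (INR (S k) * th))) in E
    by (intros k _; now rewrite pow1, Rmult_1_l).
  rewrite pow1, !pow1 in E.
  set (X := rsum _ _) in *.
  assert (B0 := COS_bound th). assert (Bn := COS_bound (INR n * th)).
  assert (BSn := COS_bound (INR (S n) * th)).
  apply Rle_div_r; [lra|]. rewrite <- (Rabs_pos_eq (1 - cos th)), <- Rabs_mult by lra.
  apply Rabs_le. lra.
Qed.

Lemma is_series_cos_pow r th : 0 <= r < 1 ->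
  is_series (fun k => r ^ S k * cos (INR (S k) * th))
    ((r * cos th - r ^ 2) / (1 - 2 * r * cos th + r ^ 2)).
Proof.
  intros Hr. set (P := 1 - 2 * r * cos th + r ^ 2).
  assert (HP : 0 < P) by (unfold P; generalize (COS_bound th); nra).
  apply is_series_rsum.
  apply (is_lim_seq_ext (fun n => / P * (r * cos th - r ^ 2
    + r ^ S n * (r * cos (INR n * th) - cos (INR (S n) * th))))).
  { intros n. rewrite <- rsum_cos_pow. fold P. field. lra. }
  replace ((r * cos th - r ^ 2) / P) with (/ P * (r * cos th - r ^ 2 + 0)) by (field; lra).
  apply (is_lim_seq_scal_l _ (/ P) (Finite _)), is_lim_seq_plus'; [apply is_lim_seq_const|].
  assert (Hgeom : is_lim_seq (fun n => 2 * r ^ S n) 0).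
  { replace (Finite 0) with (Rbar_mult 2 0) by (simpl; f_equal; ring).
    apply is_lim_seq_scal_l, (is_lim_seq_incr_1 (fun n => r ^ n)), is_lim_seq_geom.
    rewrite Rabs_pos_eq; lra. }
  apply is_lim_seq_abs_0, (is_lim_seq_le_le (fun _ => 0) _ (fun n => 2 * r ^ S n));
    [|apply is_lim_seq_const|exact Hgeom].
  intros n. split; [apply Rabs_pos|].
  assert (Hrn : 0 <= r ^ S n) by (apply pow_le; lra).
  rewrite Rabs_mult, (Rabs_pos_eq _ Hrn), Rmult_comm. apply Rmult_le_compat_r; [exact Hrn|].
  generalize (COS_bound (INR n * th)) (COS_bound (INR (S n) * th)). intros.
  apply Rabs_le. nra.
Qed.

Lemma is_series_cos_exp y th : 0 < y ->
  is_series (fun k => exp (- (INR (S k) * y)) * cos (INR (S k) * th)) ((poisson y th - 1) / 2).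
Proof.
  intros Hy. assert (Hden := cosh_minus_cos_pos y th Hy).
  set (r := exp (- y)). assert (Hr : 0 < r) by apply exp_pos.
  assert (Hr1 : r < 1) by (unfold r; rewrite <- exp_0; apply exp_increasing; lra).
  assert (Ey : exp y = / r) by (unfold r; now rewrite exp_Ropp, Rinv_inv).
  apply (is_series_ext (fun k => r ^ S k * cos (INR (S k) * th)));
    [intros k; now rewrite exp_opp_pow|].
  replace ((poisson y th - 1) / 2)
    with ((r * cos th - r ^ 2) / (1 - 2 * r * cos th + r ^ 2));
    [apply is_series_cos_pow; lra|].
  assert (EP : 1 - 2 * r * cos th + r ^ 2 = 2 * r * (cosh y - cos th)).
  { unfold cosh. rewrite Ey. fold r. field. lra. }
  rewrite EP. unfold poisson.
  assert (Esinh : sinh y = (/ r - r) / 2) by (unfold sinh; now rewrite Ey).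
  assert (Ecosh : cosh y = (/ r + r) / 2) by (unfold cosh; now rewrite Ey).
  rewrite Esinh. apply Rmult_eq_reg_r with (cosh y - cos th); [|lra].
  field_simplify; [|lra|lra]. rewrite Ecosh. field. lra.
Qed.

Lemma is_series_exp_opp y : 0 < y ->
  is_series (fun k => exp (- (INR (S k) * y))) (/ (exp y - 1)).
Proof.
  intros Hy. assert (Hey := exp_gt_1 y Hy).
  assert (Hr : Rabs (exp (- y)) < 1).
  { rewrite Rabs_pos_eq by (left; apply exp_pos). rewrite <- exp_0. apply exp_increasing. lra. }
  replace (/ (exp y - 1)) with (exp (- y) * / (1 - exp (- y)))
    by (rewrite exp_Ropp; field; lra).
  apply (is_series_ext (fun k => scal (exp (- y)) (exp (- y) ^ k)));
    [intros k; now rewrite exp_opp_pow|].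
  now apply (is_series_scal_l (V := R_NormedModule)), is_series_geom.
Qed.

(** * Periodic sequences *)

Lemma periodic_mod {A} (f : nat -> A) q :
  (forall n, f (n + q)%nat = f n) -> forall n, f n = f (n mod q)%nat.
Proof.
  intros Hf n. rewrite (Nat.div_mod_eq n q) at 1.
  generalize (n mod q)%nat as r. induction (n / q)%nat as [|k IH]; intros r.
  - now rewrite Nat.mul_0_r.
  - rewrite <- (IH r), <- (Hf (q * k + r)%nat). f_equal. lia.
Qed.

Lemma periodic_bounded (f : nat -> R) q :
  (0 < q)%nat -> (forall n, f (n + q)%nat = f n) -> exists C, forall n, Rabs (f n) <= C.
Proof.
  intros Hq Hf. exists (rsum (fun n => Rabs (f n)) (seq 0 q)). intros n.
  rewrite (periodic_mod f q Hf n).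
  apply (rsum_ge_term (fun n => Rabs (f n))); [intros; apply Rabs_pos|].
  apply in_seq. generalize (Nat.mod_upper_bound n q). lia.
Qed.

Lemma rsum_period_shift (f : nat -> R) q k :
  (forall n, f (n + q)%nat = f n) -> rsum f (seq k q) = rsum f (seq 0 q).
Proof.
  intros Hf. induction k as [|k IH]; [reflexivity|]. rewrite <- IH.
  assert (E := lsum_seq_S (op := Rplus) (e := 0) f k q).
  simpl seq in E. rewrite lsum_cons, Hf in E. lra.
Qed.

Record balanced {T : Type} (op : T -> T -> T) (e : T) (q : nat) (v : nat -> T) : Prop := {
  balanced_modulus : (0 < q)%nat;
  balanced_periodic : forall n, v (n + q)%nat = v n;
  balanced_0 : v O = e;
  balanced_sum : lsum op e v (seq 0 q) = e
}.

Notation balanced_R := (balanced Rplus 0).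
Notation balanced_C := (balanced Cplus (RtoC 0)).

Lemma balanced_morphism {T U : Type} (op : T -> T -> T) (e : T) (op' : U -> U -> U) (e' : U)
    (phi : T -> U) q v :
  phi e = e' -> (forall x y, phi (op x y) = op' (phi x) (phi y)) ->
  balanced op e q v -> balanced op' e' q (fun n => phi (v n)).
Proof.
  intros He Hop [Hq Hper H0 Hsum]. split; [exact Hq| | |].
  - intros n. now rewrite Hper.
  - now rewrite H0.
  - now rewrite <- (lsum_morphism op e op' e' phi v), Hsum.
Qed.

Lemma balanced_bounded q v : balanced_R q v -> exists C, forall n, Rabs (v n) <= C.
Proof. intros [Hq Hper _ _]. now apply periodic_bounded with q. Qed.

Lemma balanced_partial_sums_bounded q v : balanced_R q v ->
  exists C, forall n, Rabs (rsum (fun k => v (S k)) (seq 0 n)) <= C.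
Proof.
  intros [Hq Hper H0 Hsum].
  destruct (periodic_bounded (fun n => rsum v (seq 0 n)) q Hq) as [C HC].
  { intros n. rewrite lsum_seq_split, (rsum_period_shift v q), Hsum by exact Hper. ring. }
  exists C. intros n. specialize (HC (S n)). simpl seq in HC.
  now rewrite lsum_cons, (lsum_seq_shift v 1 0), H0, Rplus_0_l in HC.
Qed.

Lemma is_lim_seq_div_INR_S c : is_lim_seq (fun n => c / INR (S n)) 0.
Proof.
  replace (Finite 0) with (Rbar_mult c 0) by (simpl; f_equal; ring).
  apply (is_lim_seq_scal_l (fun n => / INR (S n))), (is_lim_seq_incr_1 (fun n => / INR n)).
  apply (is_lim_seq_inv INR p_infty); [apply is_lim_seq_INR|discriminate].
Qed.

Lemma ex_series_div_INR_S (w : nat -> R) C :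
  (forall n, Rabs (rsum w (seq 0 n)) <= C) -> ex_series (fun n => w n / INR (S n)).
Proof.
  intros HC. assert (Hpos : forall n, 0 < INR (S n)) by (intros n; apply lt_0_INR; lia).
  apply (ex_series_dirichlet w (fun n => / INR (S n)) C); [exact HC| | |].
  - intros n. left. apply Rinv_0_lt_compat, Hpos.
  - intros n. apply Rinv_le_contravar; [apply Hpos|apply le_INR; lia].
  - apply (is_lim_seq_ext (fun n => 1 / INR (S n))); [intros n; apply Rmult_1_l|].
    apply is_lim_seq_div_INR_S.
Qed.

Lemma rsum_blocks (f : nat -> R) q n :
  rsum f (seq 0 (n * q)) = rsum (fun k => rsum (fun h => f (k * q + h)%nat) (seq 0 q)) (seq 0 n).
Proof.
  induction n as [|n IH]; [reflexivity|].
  rewrite lsum_seq_S, <- IH, <- (lsum_seq_shift f (n * q) 0).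
  replace (S n * q)%nat with (n * q + q)%nat by lia. rewrite lsum_seq_split. do 3 f_equal. lia.
Qed.

Lemma is_series_of_blocks (f : nat -> R) q (l : R) : (0 < q)%nat -> ex_series f ->
  is_series (fun k => rsum (fun h => f (k * q + h)%nat) (seq 0 q)) l -> is_series f l.
Proof.
  intros Hq [l' Hf] Hl. enough (E : l' = l) by (now rewrite <- E).
  apply is_series_rsum in Hl. assert (Hf' := proj1 (is_series_rsum f l') Hf).
  apply (is_lim_seq_subseq _ _ (fun n => n * q)%nat) in Hf';
    [|apply eventually_subseq; intros n; nia].
  apply (is_lim_seq_ext _ _ _ (fun n => rsum_blocks f q n)) in Hf'.
  apply is_lim_seq_unique in Hl, Hf'. rewrite Hl in Hf'. now injection Hf'.
Qed.

(** * The cosine transform *)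

Definition even_mod {T : Type} (q : nat) (v : nat -> T) : Prop :=
  forall h, (h <= q)%nat -> v (q - h)%nat = v h.

Definition angle (q h : nat) : R := 2 * PI / INR q * INR h.

Definition cosine_transform (q : nat) (v : nat -> R) (d : nat) : R :=
  / INR q * rsum (fun h => v h * cos (INR d * angle q h)) (seq 0 q).

Definition poisson_avg (q : nat) (v : nat -> R) (y : R) : R :=
  / (2 * INR q) * rsum (fun h => v h * poisson y (angle q h)) (seq 0 q).

Lemma angle_step_pos q : (0 < q)%nat -> 0 < 2 * PI / INR q.
Proof. intros Hq. apply Rdiv_lt_0_compat; [generalize PI_RGT_0; lra|now apply lt_0_INR]. Qed.

Lemma angle_pos q h : (0 < q)%nat -> (0 < h)%nat -> 0 < angle q h.
Proof. intros Hq Hh. apply Rmult_lt_0_compat; [now apply angle_step_pos|now apply lt_0_INR]. Qed.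

Lemma angle_lt_2PI q h : (h < q)%nat -> angle q h < 2 * PI.
Proof.
  intros Hh. assert (Hq : 0 < INR q) by (apply lt_0_INR; lia).
  unfold angle. replace (2 * PI) with (2 * PI / INR q * INR q) at 2 by (field; lra).
  apply Rmult_lt_compat_l; [apply angle_step_pos; lia|now apply lt_INR].
Qed.

Lemma angle_bounds q h : (h < q)%nat -> 0 <= angle q h <= 2 * PI.
Proof.
  intros Hh. split; [|left; now apply angle_lt_2PI].
  apply Rmult_le_pos; [left; apply angle_step_pos; lia|apply pos_INR].
Qed.

Lemma cos_lt_1 th : 0 < th < 2 * PI -> cos th < 1.
Proof.
  intros Hth. assert (Hsin : 0 < sin (th / 2)) by (apply sin_gt_0; lra).
  generalize (one_minus_cos th) (pow_lt _ 2 Hsin). lra.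
Qed.

Lemma rsum_reflect (v F : nat -> R) q : v O = 0 -> even_mod q v ->
  rsum (fun h => v h * F (q - h)%nat) (seq 0 q) = rsum (fun h => v h * F h) (seq 0 q).
Proof.
  intros H0 Hv. destruct q as [|p]; [reflexivity|]. simpl seq.
  rewrite !lsum_cons, H0, !Rmult_0_l. f_equal.
  rewrite !(lsum_seq_shift _ 1 0), lsum_seq_rev. apply lsum_ext. intros k Hk. apply in_seq in Hk.
  rewrite <- (Hv (1 + (p - 1 - k))%nat) by lia. f_equal; f_equal; lia.
Qed.

Lemma continuous_poisson_avg q v al s :
  0 < al -> continuous (fun s => poisson_avg q v (al * exp s)) s.
Proof.
  intros Hal. apply (continuous_scal_r (V := R_NormedModule) (/ (2 * INR q))).
  apply (continuous_rsum (fun h s => v h * poisson (al * exp s) (angle q h))). intros h _.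
  apply (continuous_scal_r (V := R_NormedModule) (v h)).
  unfold poisson. continuous_by_derive.
  assert (Hden := cosh_minus_cos_pos (al * exp s) (angle q h)
    ltac:(apply Rmult_lt_0_compat; [exact Hal|apply exp_pos])).
  lra.
Qed.

Section CosineTransform.

Variables (q : nat) (v : nat -> R).
Hypothesis v_balanced : balanced_R q v.
Hypothesis v_even : even_mod q v.

Let u : nat -> R := cosine_transform q v.
Let q_pos : (0 < q)%nat := balanced_modulus _ _ _ _ v_balanced.
Let INR_q_pos : 0 < INR q := lt_0_INR q q_pos.

Lemma cosine_transform_bounded : exists U, forall d, Rabs (u d) <= U.
Proof.
  exists (/ INR q * rsum (fun h => Rabs (v h)) (seq 0 q)). intros d. unfold u, cosine_transform.
  assert (Hinv : 0 < / INR q) by now apply Rinv_0_lt_compat.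
  rewrite Rabs_mult, Rabs_pos_eq by lra. apply Rmult_le_compat_l; [lra|].
  eapply Rle_trans; [apply Rabs_rsum_le|]. apply rsum_le. intros h _.
  rewrite Rabs_mult. rewrite <- (Rmult_1_r (Rabs (v h))) at 2.
  apply Rmult_le_compat_l; [apply Rabs_pos|]. apply Rabs_le, COS_bound.
Qed.

Lemma cosine_transform_partial_sums_bounded :
  exists C, forall n, Rabs (rsum (fun k => u (S k)) (seq 0 n)) <= C.
Proof.
  exists (/ INR q * rsum (fun h => Rabs (v h) * (2 / (1 - cos (angle q h)))) (seq 0 q)). intros n.
  assert (Hinv : 0 < / INR q) by now apply Rinv_0_lt_compat.
  unfold u, cosine_transform. rewrite rsum_mult_l, lsum_swap, Rabs_mult, Rabs_pos_eq by lra.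
  apply Rmult_le_compat_l; [lra|]. eapply Rle_trans; [apply Rabs_rsum_le|].
  apply rsum_le. intros h Hh. apply in_seq in Hh. rewrite rsum_mult_l, Rabs_mult.
  destruct (Nat.eq_dec h 0) as [->|Hh0].
  - rewrite (balanced_0 _ _ _ _ v_balanced), Rabs_R0, !Rmult_0_l. apply Rle_refl.
  - apply Rmult_le_compat_l; [apply Rabs_pos|]. apply Rabs_rsum_cos_le, cos_lt_1.
    split; [apply angle_pos; lia|apply angle_lt_2PI; lia].
Qed.

Lemma is_series_poisson_avg_exp y : 0 < y ->
  is_series (fun n => u (S n) * exp (- (INR (S n) * y))) (poisson_avg q v y).
Proof.
  intros Hy.
  replace (poisson_avg q v y)
    with (/ INR q * rsum (fun h => v h * ((poisson y (angle q h) - 1) / 2)) (seq 0 q)).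
  - apply (is_series_ext (fun n => / INR q *
      rsum (fun h => v h * (exp (- (INR (S n) * y)) * cos (INR (S n) * angle q h))) (seq 0 q))).
    { intros n. unfold u, cosine_transform. rewrite Rmult_assoc, <- rsum_mult_r. f_equal.
      apply lsum_ext. intros h _. ring. }
    apply (is_series_scal_l (V := R_NormedModule)), is_series_lsum. intros h _.
    now apply (is_series_scal_l (V := R_NormedModule)), is_series_cos_exp.
  - rewrite (lsum_ext _ (fun h => / 2 * (v h * poisson y (angle q h)) + - / 2 * v h))
      by (intros h _; field).
    rewrite lsum_op, !rsum_mult_l, (balanced_sum _ _ _ _ v_balanced).
    unfold poisson_avg. field. lra.
Qed.

Lemma ex_series_lorentz_angle y :
  0 < y -> ex_series (fun n => / INR q * lorentz y (angle q (S n))).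
Proof.
  intros Hy. apply (ex_series_scal_l (/ INR q) (fun n => lorentz y (angle q (S n)))).
  apply ex_series_lorentz; [exact Hy|now apply angle_step_pos].
Qed.

Lemma rsum_lorentz_block y k :
  rsum (fun h => v (k * q + h)%nat * (/ INR q * lorentz y (angle q (k * q + h)))) (seq 0 q)
  = / (2 * INR q) * rsum (fun h => v h * lorentz_pair y (angle q h) k) (seq 0 q).
Proof.
  set (F := fun h => lorentz y (angle q (k * q + h))).
  rewrite (lsum_ext _ (fun h => / INR q * (v h * F h))).
  - rewrite rsum_mult_l.
    rewrite (lsum_ext (fun h => v h * lorentz_pair _ _ _)
      (fun h => v h * F h + v h * F (q - h)%nat)).
    + rewrite lsum_op, (rsum_reflect v F q (balanced_0 _ _ _ _ v_balanced) v_even). field. lra.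
    + intros h Hh. apply in_seq in Hh. unfold lorentz_pair, F.
      rewrite <- (lorentz_opp y (angle q h - _)), <- Rmult_plus_distr_l. do 2 f_equal;
        unfold angle; rewrite !plus_INR, mult_INR, ?minus_INR, ?S_INR by lia.
      * f_equal. field. lra.
      * f_equal. field. lra.
  - intros h _. rewrite (periodic_mod v q (balanced_periodic _ _ _ _ v_balanced) (k * q + h)).
    rewrite Nat.add_comm, Nat.Div0.mod_add, <- periodic_mod by apply v_balanced.
    unfold F. rewrite (Nat.add_comm h). ring.
Qed.

Lemma is_series_poisson_avg_lorentz y : 0 < y ->
  is_series (fun n => v (S n) * (/ INR q * lorentz y (angle q (S n)))) (poisson_avg q v y).
Proof.
  intros Hy. set (f := fun n => v n * (/ INR q * lorentz y (angle q n))).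
  assert (Hf0 : f O = 0).
  { unfold f. rewrite (balanced_0 _ _ _ _ v_balanced). ring. }
  enough (Hf : is_series f (poisson_avg q v y)).
  { apply (is_series_incr_1 f). change (is_series f (poisson_avg q v y + f O)).
    now rewrite Hf0, Rplus_0_r. }
  apply is_series_of_blocks with q; [exact q_pos| |].
  - apply ex_series_incr_1, ex_series_Rabs. destruct (balanced_bounded q v v_balanced) as [V HV].
    apply (ex_series_Rabs_bounded_mult (fun n => v (S n)) _ V); [auto| |].
    + intros n. apply Rmult_le_pos; [left; now apply Rinv_0_lt_compat|now apply lorentz_ge_0].
    + now apply ex_series_lorentz_angle.
  - apply (is_series_ext (fun k => / (2 * INR q) *
      rsum (fun h => v h * lorentz_pair y (angle q h) k) (seq 0 q)));
      [intros k; symmetry; apply rsum_lorentz_block|].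
    apply (is_series_scal_l (V := R_NormedModule)), is_series_lsum. intros h Hh.
    apply (is_series_scal_l (V := R_NormedModule)), is_series_poisson; [exact Hy|].
    apply angle_bounds. apply in_seq in Hh. lia.
Qed.

End CosineTransform.

(** * Pairs of exponentials and pairs of Lorentz kernels *)

Lemma mult_exp_pos al s : 0 < al -> 0 < al * exp s.
Proof. intros Hal. apply Rmult_lt_0_compat; [exact Hal|apply exp_pos]. Qed.

Lemma mult_exp_mult_exp_opp al s : al * exp s * (al * exp (- s)) = al ^ 2.
Proof.
  transitivity (al ^ 2 * (exp s * exp (- s))); [ring|]. rewrite exp_mult_exp_opp. ring.
Qed.

Lemma exp_opp_half_le z : 0 < z -> exp (- (z / 2)) <= 16 / z ^ 2.
Proof.
  intros Hz. replace (- (z / 2)) with (- (z / 4) + - (z / 4)) by field.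
  replace (16 / z ^ 2) with (/ (z / 4) * / (z / 4)) by (field; lra).
  rewrite exp_plus. apply Rmult_le_compat; try (left; apply exp_pos); apply exp_opp_le_inv; lra.
Qed.

Lemma exp_pair_le al d m s : 0 < al -> 1 <= d -> 1 <= m ->
  exp (- (d * (al * exp s))) * exp (- (m * (al * exp (- s))))
  <= 256 / al ^ 5 * inv_pow_3_2 d * inv_pow_3_2 m * / cosh (s / 2).
Proof.
  intros Hal Hd Hm.
  assert (Hy := mult_exp_pos al s Hal). assert (Hw := mult_exp_pos al (- s) Hal).
  assert (Eyw := mult_exp_mult_exp_opp al s).
  assert (Esum : al * exp s + al * exp (- s) = 2 * (al * cosh s)) by (unfold cosh; field).
  set (y := al * exp s) in *. set (w := al * exp (- s)) in *.
  assert (Hcosh := cosh_ge_1 (s / 2)). assert (Hhalf := cosh_half_le s).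
  assert (Hdy : y <= d * y) by nra. assert (Hmw : w <= m * w) by nra.
  assert (Hdecay : exp (- (d * y / 2)) * exp (- (m * w / 2)) <= / (al * cosh (s / 2))).
  { rewrite <- exp_plus. apply Rle_trans with (exp (- (al * cosh s))).
    - apply exp_le_compat. lra.
    - eapply Rle_trans; [apply exp_opp_le_inv; nra|]. apply Rinv_le_contravar; nra. }
  replace (exp (- (d * y)) * exp (- (m * w)))
    with ((exp (- (d * y / 2)) * exp (- (m * w / 2)))
          * (exp (- (d * y / 2)) * exp (- (m * w / 2))))
    by (rewrite <- !exp_plus; f_equal; field).
  apply Rle_trans with (256 / al ^ 5 * (/ d ^ 2 * / m ^ 2) * / cosh (s / 2)).
  2:{ rewrite (Rmult_assoc _ (inv_pow_3_2 d)).
      apply Rmult_le_compat_r; [left; apply Rinv_0_lt_compat; lra|].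
      apply Rmult_le_compat_l; [left; apply Rdiv_lt_0_compat; [lra|now apply pow_lt]|].
      apply Rmult_le_compat; try (left; apply Rinv_0_lt_compat, pow_lt; lra);
        now apply inv_sqr_le_inv_pow_3_2. }
  replace (256 / al ^ 5 * (/ d ^ 2 * / m ^ 2) * / cosh (s / 2))
    with (16 / (d * y) ^ 2 * (16 / (m * w) ^ 2) * / (al * cosh (s / 2))).
  - apply Rmult_le_compat; [| |apply Rmult_le_compat|exact Hdecay];
      try (apply Rmult_le_pos); try (left; apply exp_pos); apply exp_opp_half_le; lra.
  - replace (al ^ 5) with ((y * w) ^ 2 * al) by (rewrite Eyw; ring).
    field. repeat split; lra.
Qed.

Lemma is_RInt_line_lorentz al b : 0 < al -> 0 < b ->
  is_RInt_line (fun s => lorentz (al * exp s) b) (PI / b).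
Proof.
  intros Hal Hb. replace (PI / b) with (2 / b * (PI / 2) - 2 / b * 0) by (field; lra).
  apply (is_RInt_gen_antiderivative (fun s => 2 / b * atan (al / b * exp (1 * s))) _
    (Rbar_locally m_infty) (Rbar_locally p_infty)).
  - intros s. auto_derive; [auto|]. unfold lorentz, Rsqr. rewrite !Rmult_1_l.
    field. repeat split; try lra; apply Rgt_not_eq; nra.
  - intros s. apply continuous_lorentz; [now continuous_by_derive|now apply mult_exp_pos].
  - apply (is_lim_scal_l _ (2 / b) m_infty 0), is_lim_atan_exp_m_infty. lra.
  - apply (is_lim_scal_l _ (2 / b) p_infty (PI / 2)), is_lim_atan_exp_p_infty;
      [now apply Rdiv_lt_0_compat|lra].
Qed.

Lemma is_RInt_line_lorentz_pair al b c : 0 < al -> 0 < b -> 0 < c -> al ^ 2 <> b * c ->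
  is_RInt_line (fun s => lorentz (al * exp s) b * lorentz (al * exp (- s)) c)
    (4 * al ^ 2 * ln (al ^ 2 / (b * c)) / ((al ^ 2) ^ 2 - (b * c) ^ 2)).
Proof.
  intros Hal Hb Hc Hne.
  assert (Hbc : 0 < b * c) by now apply Rmult_lt_0_compat.
  assert (Hal2 := pow_lt al 2 Hal). assert (Hb2 := pow_lt b 2 Hb). assert (Hc2 := pow_lt c 2 Hc).
  assert (Hne2 : (al ^ 2) ^ 2 - (b * c) ^ 2 <> 0).
  { replace ((al ^ 2) ^ 2 - (b * c) ^ 2) with ((al ^ 2 - b * c) * (al ^ 2 + b * c)) by ring.
    apply Rmult_integral_contrapositive_currified; lra. }
  assert (Hlog := is_RInt_line_log (al ^ 2) (b ^ 2) (c ^ 2) Hal2 Hb2 Hc2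
    ltac:(rewrite <- Rpow_mult_distr; lra)).
  apply (is_RInt_line_mult_l (4 * al ^ 2)) in Hlog. rewrite <- Rpow_mult_distr in Hlog.
  replace ((al ^ 2) ^ 2 / (b * c) ^ 2) with ((al ^ 2 / (b * c)) ^ 2) in Hlog by (field; lra).
  rewrite ln_pow in Hlog by now apply Rdiv_lt_0_compat.
  replace (4 * al ^ 2 * ln (al ^ 2 / (b * c)) / ((al ^ 2) ^ 2 - (b * c) ^ 2))
    with (4 * al ^ 2 * (INR 2 * ln (al ^ 2 / (b * c)) / (2 * ((al ^ 2) ^ 2 - (b * c) ^ 2))))
    by (simpl INR; field; exact Hne2).
  revert Hlog. apply is_RInt_line_ext. intros s.
  assert (Esqr : forall t, al ^ 2 * exp (2 * t) = (al * exp t) ^ 2).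
  { intros t. replace (2 * t) with (t + t) by ring. rewrite exp_plus. ring. }
  rewrite Ropp_mult_distr_r, !Esqr, <- (mult_exp_mult_exp_opp al s). unfold lorentz.
  assert (Hy := sqr_plus_sqr_pos (al * exp s) b (mult_exp_pos al s Hal)).
  assert (Hw := sqr_plus_sqr_pos (al * exp (- s)) c (mult_exp_pos al (- s) Hal)).
  field. lra.
Qed.

Lemma mult_cube_le_quartic p r : 0 <= p -> 0 <= r -> p * r ^ 3 <= p ^ 4 + r ^ 4.
Proof.
  intros Hp Hr. assert (Hp4 : 0 <= p ^ 4) by now apply pow_le.
  assert (Hr4 : 0 <= r ^ 4) by now apply pow_le. destruct (Rle_dec p r) as [Hpr|Hpr].
  - assert (p * r ^ 3 <= r * r ^ 3) by (apply Rmult_le_compat_r; [now apply pow_le|exact Hpr]).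
    simpl in *. lra.
  - assert (r ^ 3 <= p ^ 3) by (apply pow_incr; lra).
    assert (p * r ^ 3 <= p * p ^ 3) by (apply Rmult_le_compat_l; lra). simpl in *. lra.
Qed.

Lemma sqrt_le_inv_pow_3_2 y b : 0 < y -> 0 < b -> sqrt y <= (y ^ 2 + b ^ 2) * inv_pow_3_2 b.
Proof.
  intros Hy Hb. assert (Sb := sqrt_lt_R0 b Hb). assert (Hb32 : 0 < b * sqrt b) by nra.
  apply Rle_div_r; [exact Hb32|].
  assert (Q := mult_cube_le_quartic (sqrt y) (sqrt b) (sqrt_pos y) (sqrt_pos b)).
  replace (y ^ 2) with (sqrt y ^ 4); [replace (b ^ 2) with (sqrt b ^ 4)|].
  - replace (sqrt y * (b * sqrt b)) with (sqrt y * sqrt b ^ 3); [exact Q|].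
    rewrite <- (sqrt_sqrt b) at 2 by lra. ring.
  - rewrite <- (sqrt_sqrt b) at 2 by lra. ring.
  - rewrite <- (sqrt_sqrt y) at 2 by lra. ring.
Qed.

Lemma sqrt_lower_le_inv_pow_3_2 k y b :
  0 < k <= b -> sqrt k <= (y ^ 2 + b ^ 2) * inv_pow_3_2 b.
Proof.
  intros Hk. assert (Sb := sqrt_lt_R0 b ltac:(lra)). assert (Eb := sqrt_sqrt b ltac:(lra)).
  apply Rle_div_r; [nra|].
  assert (Hkb : sqrt k <= sqrt b) by (apply sqrt_le_1; lra).
  generalize (pow2_ge_0 y) (sqrt_pos k). intros.
  apply Rle_trans with (sqrt b * (b * sqrt b)); [apply Rmult_le_compat_r; nra|nra].
Qed.

Lemma lorentz_denominators_ge k y w b c : 0 < y -> 0 < w -> 0 < k <= b -> k <= c ->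
  sqrt k * ((sqrt y + sqrt w) / 2)
  <= (y ^ 2 + b ^ 2) * (w ^ 2 + c ^ 2) * (inv_pow_3_2 b * inv_pow_3_2 c).
Proof.
  intros Hy Hw Hb Hc.
  assert (Hyk := Rmult_le_compat _ _ _ _ (sqrt_pos y) (sqrt_pos k)
    (sqrt_le_inv_pow_3_2 y b Hy ltac:(lra)) (sqrt_lower_le_inv_pow_3_2 k w c ltac:(lra))).
  assert (Hkw := Rmult_le_compat _ _ _ _ (sqrt_pos k) (sqrt_pos w)
    (sqrt_lower_le_inv_pow_3_2 k y b Hb) (sqrt_le_inv_pow_3_2 w c Hw ltac:(lra))).
  lra.
Qed.

Lemma lorentz_pair_le k al b c s : 0 < al -> 0 < k <= b -> k <= c ->
  lorentz (al * exp s) b * lorentz (al * exp (- s)) c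
  <= 4 * al ^ 2 / (sqrt k * sqrt al) * (inv_pow_3_2 b * inv_pow_3_2 c) * / cosh (s / 2).
Proof.
  intros Hal Hb Hc.
  assert (Hy := mult_exp_pos al s Hal). assert (Hw := mult_exp_pos al (- s) Hal).
  assert (Eal := mult_exp_mult_exp_opp al s).
  assert (Esqrt : forall t, sqrt (al * exp t) = sqrt al * exp (t / 2)).
  { intros t. rewrite sqrt_mult by (lra || (left; apply exp_pos)). f_equal.
    replace t with (t / 2 + t / 2) at 1 by field. rewrite exp_plus.
    apply sqrt_square. left. apply exp_pos. }
  assert (Ecosh : (sqrt (al * exp s) + sqrt (al * exp (- s))) / 2 = sqrt al * cosh (s / 2)).
  { rewrite !Esqrt. unfold cosh. replace (- s / 2) with (- (s / 2)) by field. field. }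
  assert (Hden := lorentz_denominators_ge k _ _ b c Hy Hw Hb Hc). rewrite Ecosh in Hden.
  set (y := al * exp s) in *. set (w := al * exp (- s)) in *.
  assert (HP := Rmult_lt_0_compat _ _ (sqr_plus_sqr_pos y b Hy) (sqr_plus_sqr_pos w c Hw)).
  assert (Hcosh := cosh_ge_1 (s / 2)).
  assert (Sk := sqrt_lt_R0 k ltac:(lra)). assert (Sal := sqrt_lt_R0 al Hal).
  assert (HQ : 0 < sqrt k * (sqrt al * cosh (s / 2)))
    by (apply Rmult_lt_0_compat; [exact Sk|apply Rmult_lt_0_compat; lra]).
  replace (lorentz y b * lorentz w c) with (4 * al ^ 2 / ((y ^ 2 + b ^ 2) * (w ^ 2 + c ^ 2)))
    by (rewrite <- Eal; unfold lorentz; field;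
        generalize (sqr_plus_sqr_pos y b Hy) (sqr_plus_sqr_pos w c Hw); lra).
  set (P := (y ^ 2 + b ^ 2) * (w ^ 2 + c ^ 2)) in *. set (I := inv_pow_3_2 b * _) in *.
  replace (4 * al ^ 2 / (sqrt k * sqrt al) * I * / cosh (s / 2))
    with (4 * al ^ 2 * (I / (sqrt k * (sqrt al * cosh (s / 2))))) by (field; lra).
  apply Rmult_le_compat_l; [generalize (pow2_ge_0 al); lra|].
  apply Rle_div_r; [exact HQ|]. rewrite Rmult_comm. apply (Rle_div_l _ _ P); [exact HP|lra].
Qed.

(** * Koshliakov's formula for periodic coefficients *)

Definition log_kernel (c : R) (n : nat) : R := ln (INR n / c) / (INR n ^ 2 - c ^ 2).

Section Koshliakov.

Variables (q : nat) (v : nat -> R) (al : R).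
Hypothesis v_balanced : balanced_R q v.
Hypothesis v_even : even_mod q v.
Hypothesis al_pos : 0 < al.

Let u : nat -> R := cosine_transform q v.
Let c : R := al ^ 2 * INR q / (4 * PI ^ 2).
Let q_pos : (0 < q)%nat := balanced_modulus _ _ _ _ v_balanced.
Let INR_q_pos : 0 < INR q := lt_0_INR q q_pos.

Lemma is_RInt_line_poisson_avg_bose :
  exists l,
    is_series (fun n => rsum u (divisors (S n)) * (2 * K0 (2 * al * sqrt (INR (S n))))) l /\
    is_RInt_line (fun s => poisson_avg q v (al * exp s) * / (exp (al * exp (- s)) - 1)) l.
Proof.
  destruct (cosine_transform_bounded q v v_balanced) as [U HU].
  assert (Hpos := fun s => mult_exp_pos al s al_pos).
  assert (HK : 0 < 256 / al ^ 5) by (apply Rdiv_lt_0_compat; [lra|now apply pow_lt]).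
  destruct (is_RInt_line_dirichlet_conv u
    (fun d s => exp (- (INR d * (al * exp s)))) (fun m s => exp (- (INR m * (al * exp (- s)))))
    (fun s => poisson_avg q v (al * exp s)) (fun s => / (exp (al * exp (- s)) - 1))
    (fun s => / cosh (s / 2))
    (fun d => 256 / al ^ 5 * inv_pow_3_2 (INR d)) (fun m => inv_pow_3_2 (INR m))
    (fun d m => 2 * K0 (2 * al * sqrt (INR d * INR m))) U (2 * PI)) as [l [Hs Hi]].
  - exact HU.
  - intros d s. continuous_by_derive. auto.
  - intros m s. continuous_by_derive. auto.
  - intros s. now apply continuous_poisson_avg.
  - intros s. continuous_by_derive. generalize (exp_gt_1 _ (Hpos (- s))). lra.
  - apply continuous_sech_half.
  - intros d s. left. apply exp_pos.
  - intros m s. left. apply exp_pos.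
  - intros s. eexists. now apply is_series_exp_opp.
  - intros s. now apply is_series_poisson_avg_exp.
  - intros s. now apply is_series_exp_opp.
  - intros n. apply Rmult_le_pos; left; [exact HK|]. apply inv_pow_3_2_pos, lt_0_INR. lia.
  - apply (ex_series_scal_l (256 / al ^ 5) (fun n => inv_pow_3_2 (INR (S n)))).
    apply ex_series_inv_pow_3_2.
  - apply ex_series_inv_pow_3_2.
  - apply is_RInt_line_sech_half.
  - intros d m s Hd Hm. now apply exp_pair_le; [|apply (le_INR 1)..].
  - intros d m Hd Hm.
    apply (is_RInt_line_ext (fun s => exp (- (al * (INR d * exp s + INR m * exp (- s)))))).
    { intros s. rewrite <- exp_plus. f_equal. ring. }
    apply is_RInt_line_K0; [exact al_pos| |]; apply lt_0_INR; lia.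
  - exists l. split; [|exact Hi]. revert Hs. apply is_series_ext. intros n.
    rewrite <- rsum_mult_r. apply lsum_ext. intros d Hd. apply in_divisors in Hd.
    now rewrite <- mult_INR, (proj2 (proj2 Hd)).
Qed.

Lemma is_RInt_line_poisson_avg_pole L :
  is_series (fun n => u (S n) / INR (S n)) L ->
  is_RInt_line (fun s => poisson_avg q v (al * exp s) * / (al * exp (- s))) (/ al ^ 2 * L).
Proof.
  intros HL. assert (Hpos := fun s => mult_exp_pos al s al_pos).
  assert (Hinv : 0 < / al) by now apply Rinv_0_lt_compat.
  destruct (cosine_transform_partial_sums_bounded q v v_balanced) as [C HC].
  apply (is_RInt_line_dirichlet (fun k => u (S k)) C
    (fun k s => / al * (exp (- (INR (S k) * al * exp s)) * exp s))
    (fun k => / al ^ 2 / INR (S k))).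
  - exact HC.
  - intros k s. continuous_by_derive. auto.
  - intros s. apply (continuous_mult (K := R_AbsRing)); [now apply continuous_poisson_avg|].
    continuous_by_derive. generalize (Hpos (- s)). lra.
  - intros k s. apply Rmult_le_pos; [lra|]. apply Rmult_le_pos; left; apply exp_pos.
  - intros k s. apply Rmult_le_compat_l; [lra|]. apply Rmult_le_compat_r; [left; apply exp_pos|].
    apply exp_le_compat. rewrite (S_INR (S k)). generalize (Hpos s). nra.
  - intros k. assert (Hk : 0 < INR (S k)) by (apply lt_0_INR; lia).
    replace (/ al ^ 2 / INR (S k)) with (/ al * / (INR (S k) * al)) by (field; lra).
    apply is_RInt_line_mult_l, is_RInt_line_exp_neg_exp. now apply Rmult_lt_0_compat.
  - apply is_lim_seq_div_INR_S.
  - intros s. assert (Hs := exp_pos s).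
    apply (is_series_ext_R (fun k =>
      u (S k) * exp (- (INR (S k) * (al * exp s))) * / (al * exp (- s)))).
    { intros k. rewrite (exp_Ropp s), (Rmult_assoc (INR (S k))). field. lra. }
    now apply is_series_scal_r, is_series_poisson_avg_exp.
  - apply (is_series_ext_R (fun n => / al ^ 2 * (u (S n) / INR (S n))));
      [intros n; unfold Rdiv; ring|].
    now apply (is_series_scal_l (V := R_NormedModule)).
Qed.

Lemma continuous_lorentz_angle d s :
  continuous (fun s => / INR q * lorentz (al * exp s) (angle q d)) s.
Proof.
  apply (continuous_scal_r (V := R_NormedModule) (/ INR q)), continuous_lorentz.
  - now continuous_by_derive.
  - now apply mult_exp_pos.
Qed.

Lemma is_RInt_line_poisson_avg L :
  is_series (fun n => v (S n) / INR (S n)) L ->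
  is_RInt_line (fun s => poisson_avg q v (al * exp s)) (/ 2 * L).
Proof.
  intros HL. assert (Hpos := fun s => mult_exp_pos al s al_pos).
  destruct (balanced_partial_sums_bounded q v v_balanced) as [C HC].
  assert (Hinv : 0 < / INR q) by now apply Rinv_0_lt_compat. assert (HPI := PI_RGT_0).
  apply (is_RInt_line_dirichlet (fun k => v (S k)) C
    (fun k s => / INR q * lorentz (al * exp s) (angle q (S k))) (fun k => / 2 / INR (S k))).
  - exact HC.
  - intros k s. now apply continuous_lorentz_angle.
  - intros s. now apply continuous_poisson_avg.
  - intros k s. apply Rmult_le_pos; [lra|now apply lorentz_ge_0].
  - intros k s. apply Rmult_le_compat_l; [lra|]. apply lorentz_decreasing; [apply Hpos|].
    split; [left; apply angle_pos; lia|].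
    apply Rmult_le_compat_l; [left; now apply angle_step_pos|apply le_INR; lia].
  - intros k. assert (Hk : 0 < INR (S k)) by (apply lt_0_INR; lia).
    replace (/ 2 / INR (S k)) with (/ INR q * (PI / angle q (S k)))
      by (unfold angle; field; lra).
    apply is_RInt_line_mult_l, is_RInt_line_lorentz; [exact al_pos|]. apply angle_pos; lia.
  - apply is_lim_seq_div_INR_S.
  - intros s. now apply is_series_poisson_avg_lorentz.
  - apply (is_series_ext_R (fun n => / 2 * (v (S n) / INR (S n))));
      [intros n; unfold Rdiv; ring|].
    now apply (is_series_scal_l (V := R_NormedModule)).
Qed.

Lemma koshliakov_c_pos : 0 < c.
Proof.
  apply Rdiv_lt_0_compat; [apply Rmult_lt_0_compat; [now apply pow_lt|exact INR_q_pos]|].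
  generalize (pow_lt PI 2 PI_RGT_0). lra.
Qed.

Hypothesis c_not_nat : forall m, (0 < m)%nat -> c <> INR m.

Lemma is_RInt_line_lorentz_angle d m : (1 <= d)%nat -> (1 <= m)%nat ->
  is_RInt_line (fun s => / INR q * lorentz (al * exp s) (angle q d)
                         * lorentz (al * exp (- s)) (2 * PI * INR m))
    (c / PI ^ 2 * log_kernel c (d * m)).
Proof.
  intros Hd Hm. assert (HPI := PI_RGT_0). assert (HPI2 := pow_lt PI 2 HPI).
  assert (HN : 0 < INR (d * m)) by (apply lt_0_INR; nia).
  assert (Hm' : 0 < INR m) by (apply lt_0_INR; lia).
  set (k := 4 * PI ^ 2 / INR q). assert (Hk : 0 < k) by (apply Rdiv_lt_0_compat; lra).
  assert (Eal : al ^ 2 = k * c) by (unfold k, c; field; lra).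
  assert (Hc := koshliakov_c_pos).
  assert (Ebc : angle q d * (2 * PI * INR m) = k * INR (d * m))
    by (unfold angle, k; rewrite mult_INR; field; lra).
  assert (Hne : c <> INR (d * m)) by (apply c_not_nat; nia).
  assert (Hint := is_RInt_line_lorentz_pair al (angle q d) (2 * PI * INR m) al_pos
    ltac:(apply angle_pos; lia) ltac:(nra)
    ltac:(rewrite Eal, Ebc; intros E; apply Rmult_eq_reg_l in E; lra)).
  apply (is_RInt_line_mult_l (/ INR q)) in Hint.
  replace (c / PI ^ 2 * log_kernel c (d * m)) with (/ INR q * (4 * al ^ 2 *
    ln (al ^ 2 / (angle q d * (2 * PI * INR m))) /
    ((al ^ 2) ^ 2 - (angle q d * (2 * PI * INR m)) ^ 2))).
  - revert Hint. apply is_RInt_line_ext. intros s. ring.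
  - unfold log_kernel. rewrite Ebc, Eal. set (N := INR (d * m)) in *.
    replace (k * c / (k * N)) with (/ (N / c)) by (field; lra).
    rewrite ln_Rinv by now apply Rdiv_lt_0_compat.
    assert (Hne2 : N ^ 2 - c ^ 2 <> 0).
    { replace (N ^ 2 - c ^ 2) with ((N - c) * (N + c)) by ring.
      apply Rmult_integral_contrapositive_currified; lra. }
    replace ((k * c) ^ 2 - (k * N) ^ 2) with (- (k ^ 2 * (N ^ 2 - c ^ 2))) by ring.
    unfold k. field. repeat split; lra.
Qed.

Lemma lorentz_pair_angle_dominated :
  exists K, 0 < K /\ forall d m s, (1 <= d)%nat -> (1 <= m)%nat ->
    / INR q * lorentz (al * exp s) (angle q d) * lorentz (al * exp (- s)) (2 * PI * INR m)
    <= K * inv_pow_3_2 (angle q d) * inv_pow_3_2 (2 * PI * INR m) * / cosh (s / 2).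
Proof.
  set (b := 2 * PI / INR q). assert (Hb : 0 < b) by now apply angle_step_pos.
  assert (HPI := PI_RGT_0). assert (Hinv : 0 < / INR q) by now apply Rinv_0_lt_compat.
  exists (/ INR q * (4 * al ^ 2 / (sqrt b * sqrt al))). split.
  - apply Rmult_lt_0_compat; [exact Hinv|]. apply Rdiv_lt_0_compat.
    + generalize (pow_lt al 2 al_pos). lra.
    + apply Rmult_lt_0_compat; now apply sqrt_lt_R0.
  - intros d m s Hd Hm. apply (le_INR 1) in Hd, Hm. simpl INR in Hd, Hm.
    assert (Hq1 : 1 <= INR q) by (apply (le_INR 1); exact q_pos).
    assert (Hbd : b <= angle q d) by (unfold angle; fold b; clearbody b; nra).
    assert (Hmq : 1 <= INR m * INR q) by nra.
    assert (Hbm : b <= 2 * PI * INR m) by (apply Rle_div_l; [exact INR_q_pos|nra]).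
    assert (Hbound := lorentz_pair_le b al (angle q d) (2 * PI * INR m) s al_pos
      (conj Hb Hbd) Hbm).
    apply (Rmult_le_compat_l (/ INR q)) in Hbound; [|lra].
    eapply Rle_trans; [|eapply Rle_trans; [exact Hbound|]]; right; ring.
Qed.

Lemma is_RInt_line_poisson_avg_bose_regular :
  exists l,
    is_series (fun n => rsum v (divisors (S n)) * log_kernel c (S n)) l /\
    is_RInt_line (fun s => poisson_avg q v (al * exp s) *
       (/ (exp (al * exp (- s)) - 1) - / (al * exp (- s)) + / 2)) (c / PI ^ 2 * l).
Proof.
  destruct (balanced_bounded q v v_balanced) as [V HV].
  destruct lorentz_pair_angle_dominated as (K & HK & Hdominated).
  assert (Hpos := fun s => mult_exp_pos al s al_pos).
  assert (Hinv : 0 < / INR q) by now apply Rinv_0_lt_compat. assert (HPI := PI_RGT_0).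
  destruct (is_RInt_line_dirichlet_conv v
    (fun d s => / INR q * lorentz (al * exp s) (angle q d))
    (fun m s => lorentz (al * exp (- s)) (2 * PI * INR m))
    (fun s => poisson_avg q v (al * exp s))
    (fun s => / (exp (al * exp (- s)) - 1) - / (al * exp (- s)) + / 2)
    (fun s => / cosh (s / 2))
    (fun d => K * inv_pow_3_2 (angle q d)) (fun m => inv_pow_3_2 (2 * PI * INR m))
    (fun d m => c / PI ^ 2 * log_kernel c (d * m)) V (2 * PI)) as [l [Hs Hi]].
  - exact HV.
  - intros d s. now apply continuous_lorentz_angle.
  - intros m s. apply continuous_lorentz; [now continuous_by_derive|apply Hpos].
  - intros s. now apply continuous_poisson_avg.
  - intros s. continuous_by_derive.
    generalize (exp_gt_1 _ (Hpos (- s))) (Hpos (- s)). intros. repeat split; lra.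
  - apply continuous_sech_half.
  - intros d s. apply Rmult_le_pos; [lra|now apply lorentz_ge_0].
  - intros m s. now apply lorentz_ge_0.
  - intros s. now apply ex_series_lorentz_angle with v.
  - intros s. now apply is_series_poisson_avg_lorentz.
  - intros s. now apply is_series_bose.
  - intros n. apply Rmult_le_pos; left; [exact HK|]. apply inv_pow_3_2_pos, angle_pos; lia.
  - apply (ex_series_scal_l K (fun n => inv_pow_3_2 (angle q (S n)))).
    now apply ex_series_inv_pow_3_2_mult, angle_step_pos.
  - apply ex_series_inv_pow_3_2_mult. lra.
  - apply is_RInt_line_sech_half.
  - exact Hdominated.
  - intros d m Hd Hm. now apply is_RInt_line_lorentz_angle.
  - assert (Hc : 0 < c / PI ^ 2)
      by (apply Rdiv_lt_0_compat; [exact koshliakov_c_pos|now apply pow_lt]).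
    set (kappa := c / PI ^ 2) in *. clearbody kappa.
    exists (/ kappa * l). split.
    + apply (is_series_scal_l (/ kappa)) in Hs. revert Hs. apply is_series_ext_R.
      intros n. change (scal ?x ?y) with (x * y). rewrite <- rsum_mult_l, <- rsum_mult_r.
      apply lsum_ext. intros d Hd. apply in_divisors in Hd.
      rewrite (proj2 (proj2 Hd)). field. lra.
    + now rewrite <- Rmult_assoc, Rinv_r, Rmult_1_l by lra.
Qed.

Lemma koshliakov :
  is_series (fun n => rsum u (divisors (S n)) * K0 (2 * al * sqrt (INR (S n))))
    (/ (2 * al ^ 2) * Series (fun n => u (S n) / INR (S n))
     - / 8 * Series (fun n => v (S n) / INR (S n))
     + c / (2 * PI ^ 2) * Series (fun n => rsum v (divisors (S n)) * log_kernel c (S n))).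
Proof.
  assert (HPI := PI_RGT_0).
  destruct (cosine_transform_partial_sums_bounded q v v_balanced) as [Cu HCu].
  destruct (balanced_partial_sums_bounded q v v_balanced) as [Cv HCv].
  set (Lu := Series (fun n => u (S n) / _)). set (Lv := Series (fun n => v (S n) / _)).
  assert (HLu : is_series (fun n => u (S n) / INR (S n)) Lu)
    by exact (Series_correct _ (ex_series_div_INR_S _ Cu HCu)).
  assert (HLv : is_series (fun n => v (S n) / INR (S n)) Lv)
    by exact (Series_correct _ (ex_series_div_INR_S _ Cv HCv)).
  destruct is_RInt_line_poisson_avg_bose as (l & Hl & Itotal).
  destruct is_RInt_line_poisson_avg_bose_regular as (T & HT & Iregular).
  rewrite (is_series_unique _ _ HT).
  assert (Ipole := is_RInt_line_poisson_avg_pole _ HLu).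
  assert (Iconst := is_RInt_line_mult_l (- / 2) _ _ (is_RInt_line_poisson_avg _ HLv)).
  assert (Isum := is_RInt_gen_plus _ _ _ _ (is_RInt_gen_plus _ _ _ _ Ipole Iconst) Iregular).
  assert (El : l = / al ^ 2 * Lu + - / 2 * (/ 2 * Lv) + c / PI ^ 2 * T).
  { rewrite <- (is_RInt_gen_unique _ _ Itotal). apply is_RInt_gen_unique.
    revert Isum. apply is_RInt_line_ext. intros s.
    unfold plus. simpl. ring. }
  replace (_ + _) with (/ 2 * l) by (rewrite El; field; lra).
  apply (is_series_scal_l (/ 2)) in Hl. revert Hl. apply is_series_ext_R.
  intros n. change (scal ?x ?y) with (x * y). field.
Qed.

End Koshliakov.

(** * Sums over residue classes *)

Lemma csum_mult_l {A} z (f : A -> C) l : csum (fun a => (z * f a)%C) l = (z * csum f l)%C.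
Proof. symmetry. apply (lsum_morphism _ _ _ _ (Cmult z)); intros; ring. Qed.

Lemma Cmult_fixed_eq_0 (z w : C) : z <> RtoC 1 -> (z * w)%C = w -> w = RtoC 0.
Proof.
  intros Hz Hw. apply NNPP. intros Hw0. apply Hz.
  transitivity (z * w * / w)%C; [field; exact Hw0|]. rewrite Hw. now apply Cinv_r.
Qed.

Lemma periodic_congr {A} (f : Z -> A) q n m :
  (forall n, f (n + q)%Z = f n) -> (q | n - m)%Z -> f n = f m.
Proof.
  intros Hf [k Hk]. replace n with (m + k * q)%Z by lia. clear Hk.
  induction k as [|k IH|k IH] using Z.peano_ind.
  - f_equal. lia.
  - rewrite <- IH, <- (Hf (m + k * q)%Z). f_equal. lia.
  - rewrite <- IH, <- (Hf (m + Z.pred k * q)%Z). f_equal. lia.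
Qed.

Lemma divide_sub_mod n q : (q | n - n mod q)%Z.
Proof.
  exists (n / q)%Z. destruct (Z.eq_dec q 0) as [->|Hq]; [rewrite Zmod_0_r; lia|].
  generalize (Z.div_mod n q Hq). lia.
Qed.

Definition residues (q : Z) : list Z := map Z.of_nat (seq 0 (Z.to_nat q)).

Lemma in_residues q n : In n (residues q) <-> (0 <= n < q)%Z.
Proof.
  unfold residues. rewrite in_map_iff. split.
  - intros (k & <- & Hk). apply in_seq in Hk. lia.
  - intros Hn. exists (Z.to_nat n). rewrite in_seq. lia.
Qed.

Lemma NoDup_residues q : NoDup (residues q).
Proof. apply Injective_map_NoDup; [|apply seq_NoDup]. intros a b. lia. Qed.

Lemma residues_eq q a b : In a (residues q) -> In b (residues q) -> (q | a - b)%Z -> a = b.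
Proof. rewrite !in_residues. intros Ha Hb [k Hk]. assert (k = 0)%Z by nia. lia. Qed.

Section Reindexing.

Context {T : Type} {op : T -> T -> T} {e : T} {CM : CommMonoid op e}.
Variables (q : Z) (f : Z -> T).
Hypothesis q_pos : (0 < q)%Z.
Hypothesis f_periodic : forall n, f (n + q)%Z = f n.

Lemma lsum_residues_reindex (s : Z -> Z) :
  (forall a b, (q | s a - s b)%Z -> (q | a - b)%Z) ->
  lsum op e (fun n => f (s n)) (residues q) = lsum op e f (residues q).
Proof.
  intros Hs. rewrite (lsum_ext _ (fun n => f ((s n) mod q)%Z)).
  - rewrite <- (lsum_map (fun n => (s n mod q)%Z) f). apply lsum_perm, Permutation_map_same_l.
    + apply Injective_map_NoDup_in; [|apply NoDup_residues].
      intros a b Ha Hb E. apply (residues_eq q); auto. apply Hs.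
      destruct (divide_sub_mod (s a) q) as [k Hk], (divide_sub_mod (s b) q) as [j Hj].
      exists (k - j)%Z. lia.
    + intros n Hn. apply in_map_iff in Hn. destruct Hn as (k & <- & _).
      now apply in_residues, Z.mod_pos_bound.
  - intros n _. apply (periodic_congr f q); [exact f_periodic|apply divide_sub_mod].
Qed.

Lemma lsum_residues_shift k :
  lsum op e (fun n => f (n + k)%Z) (residues q) = lsum op e f (residues q).
Proof.
  apply (lsum_residues_reindex (fun n => (n + k)%Z)). intros a b [j Hj]. exists j. lia.
Qed.

Lemma lsum_residues_mult_coprime n : Z.gcd n q = 1%Z ->
  lsum op e (fun k => f (n * k)%Z) (residues q) = lsum op e f (residues q).
Proof.
  intros Hn. apply (lsum_residues_reindex (fun k => (n * k)%Z)). intros a b Hab.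
  rewrite <- Z.mul_sub_distr_l in Hab. apply Z.gauss in Hab; [exact Hab|now rewrite Z.gcd_comm].
Qed.

End Reindexing.

Definition unity_root (q j : Z) : C :=
  (cos (2 * PI * IZR j / IZR q), sin (2 * PI * IZR j / IZR q)).

Lemma unity_root_plus q j k : unity_root q (j + k) = (unity_root q j * unity_root q k)%C.
Proof.
  unfold unity_root, Cmult; simpl. rewrite plus_IZR.
  replace (2 * PI * (IZR j + IZR k) / IZR q)
    with (2 * PI * IZR j / IZR q + 2 * PI * IZR k / IZR q) by (unfold Rdiv; ring).
  rewrite cos_plus, sin_plus. f_equal; ring.
Qed.

Lemma unity_root_congr q j k : (0 < q)%Z -> (q | j - k)%Z -> unity_root q j = unity_root q k.
Proof.
  intros Hq. apply (periodic_congr (unity_root q)). intros n. rewrite unity_root_plus.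
  replace (unity_root q q) with (RtoC 1); [ring|].
  unfold unity_root. assert (Hq' : 0 < IZR q) by (apply IZR_lt; lia).
  replace (2 * PI * IZR q / IZR q) with (2 * PI) by (field; lra).
  now rewrite cos_2PI, sin_2PI.
Qed.

Lemma unity_root_0 q : unity_root q 0 = RtoC 1.
Proof. unfold unity_root. unfold Rdiv. now rewrite Rmult_0_r, Rmult_0_l, cos_0, sin_0. Qed.

Lemma unity_root_eq_1 q j : (0 < q)%Z -> unity_root q j = RtoC 1 -> (q | j)%Z.
Proof.
  intros Hq. rewrite (unity_root_congr q j (j mod q) Hq (divide_sub_mod j q)).
  intros E. apply Z.mod_divide; [lia|]. apply NNPP. intros Hr.
  assert (Hb := Z.mod_pos_bound j q Hq). set (r := (j mod q)%Z) in *.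
  assert (Hr' : 0 < IZR r < IZR q) by (split; apply IZR_lt; lia).
  injection E as E _. assert (HPI := PI_RGT_0).
  enough (cos (2 * PI * IZR r / IZR q) < 1) by lra.
  apply cos_lt_1. split; [apply Rdiv_lt_0_compat|apply Rlt_div_l]; nra.
Qed.

Lemma csum_unity_root q j : (0 < q)%Z ->
  csum (fun h => unity_root q (h * j)) (residues q)
  = if Zdivide_dec q j then RtoC (IZR q) else RtoC 0.
Proof.
  intros Hq. destruct (Zdivide_dec q j) as [Hj|Hj].
  - rewrite (lsum_ext _ (fun _ => RtoC 1)).
    + unfold residues. rewrite lsum_map, <- (Z2Nat.id q), <- INR_IZR_INZ, Nat2Z.id by lia.
      induction (Z.to_nat q) as [|n IH]; [reflexivity|].
      rewrite lsum_seq_S, IH, S_INR. now rewrite RtoC_plus.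
    + intros h _. rewrite <- (unity_root_0 q). apply unity_root_congr; [exact Hq|].
      rewrite Z.sub_0_r. now apply Z.divide_mul_r.
  - apply (Cmult_fixed_eq_0 (unity_root q j)).
    + intros E. now apply Hj, unity_root_eq_1.
    + rewrite <- csum_mult_l.
      rewrite <- (lsum_residues_shift q (fun h => unity_root q (h * j)) Hq) with (k := 1%Z).
      * apply lsum_ext. intros h _. rewrite <- unity_root_plus. f_equal. ring.
      * intros n. apply unity_root_congr; [exact Hq|]. exists j. ring.
Qed.

(** * Gauss sums of even primitive characters *)

Lemma Cconj_0 : Cconj (RtoC 0) = RtoC 0.
Proof. unfold Cconj, RtoC. simpl. now rewrite Ropp_0. Qed.

Section DirichletCharacter.

Variables (q : Z) (chi : Z -> C).
Hypothesis chi_char : is_dirichlet_char q chi.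

Let q_pos : (0 < q)%Z.
Proof. destruct chi_char. lia. Qed.

Lemma char_mult m n : chi (m * n)%Z = (chi m * chi n)%C.
Proof. apply chi_char. Qed.

Lemma char_congr n m : (q | n - m)%Z -> chi n = chi m.
Proof. apply periodic_congr. apply chi_char. Qed.

Lemma char_eq_0 n : Z.gcd n q <> 1%Z -> chi n = RtoC 0.
Proof. apply chi_char. Qed.

Lemma char_1 : chi 1%Z = RtoC 1.
Proof. apply chi_char. Qed.

(* Multiplying the summation variable by [n] leaves the sum of all [|chi k|] unchanged. *)
Lemma Cmod_char_coprime n : Z.gcd n q = 1%Z -> Cmod (chi n) = 1.
Proof.
  intros Hn. set (S := rsum (fun k => Cmod (chi k)) (residues q)).
  assert (HS : 1 <= S).
  { rewrite <- Cmod_1, <- char_1, (char_congr 1 (1 mod q) (divide_sub_mod 1 q)).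
    apply (rsum_ge_term (fun k => Cmod (chi k))); [intros; apply Cmod_ge_0|].
    now apply in_residues, Z.mod_pos_bound. }
  assert (E : Cmod (chi n) * S = S).
  { unfold S at 2. rewrite <- (lsum_residues_mult_coprime q _ q_pos) with (n := n); [|..|exact Hn].
    - unfold S. rewrite <- rsum_mult_l. apply lsum_ext. intros k _.
      now rewrite char_mult, Cmod_mult.
    - intros k. f_equal. apply chi_char. }
  nra.
Qed.

Lemma char_mult_conj n : Z.gcd n q = 1%Z -> (chi n * Cconj (chi n))%C = RtoC 1.
Proof. intros Hn. rewrite <- Cmod2_conj, Cmod_char_coprime by exact Hn. f_equal. ring. Qed.

Definition twisted_gauss_sum (h : Z) : C :=
  csum (fun k => (chi k * unity_root q (k * h))%C) (residues q).

Lemma char_unity_root_periodic h n :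
  (chi (n + q) * unity_root q ((n + q) * h))%C = (chi n * unity_root q (n * h))%C.
Proof.
  f_equal; [apply chi_char|]. apply unity_root_congr; [exact q_pos|]. exists h. ring.
Qed.

Lemma gauss_sum_twisted_1 : gauss_sum q chi = twisted_gauss_sum 1.
Proof.
  unfold twisted_gauss_sum.
  rewrite <- (lsum_residues_shift q _ q_pos (char_unity_root_periodic 1) 1).
  unfold residues. rewrite lsum_map.
  transitivity (csum (fun h => (chi (Z.of_nat h) * e_q q h)%C) (seq 1 (Z.to_nat q)));
    [reflexivity|].
  rewrite (lsum_seq_shift _ 1 0). apply lsum_ext. intros k _. f_equal; [f_equal; lia|].
  unfold e_q, unity_root. rewrite INR_IZR_INZ.
  now replace ((Z.of_nat k + 1) * 1)%Z with (Z.of_nat (1 + k)) by lia.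
Qed.

Lemma twisted_gauss_sum_coprime h : Z.gcd h q = 1%Z ->
  twisted_gauss_sum h = (gauss_sum q chi * Cconj (chi h))%C.
Proof.
  intros Hh.
  assert (E : (chi h * twisted_gauss_sum h)%C = gauss_sum q chi).
  { rewrite gauss_sum_twisted_1. unfold twisted_gauss_sum.
    rewrite <- (lsum_residues_mult_coprime q _ q_pos (char_unity_root_periodic 1) h Hh).
    rewrite <- csum_mult_l. apply lsum_ext. intros k _.
    rewrite char_mult, Cmult_assoc. do 2 f_equal. ring. }
  rewrite <- E.
  transitivity (twisted_gauss_sum h * (chi h * Cconj (chi h)))%C; [|ring].
  rewrite char_mult_conj by exact Hh. ring.
Qed.

Lemma char_sum_0 : ~ is_principal q chi -> csum chi (residues q) = RtoC 0.
Proof.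
  intros Hchi. apply not_all_ex_not in Hchi. destruct Hchi as [n Hn].
  apply imply_to_and in Hn. destruct Hn as [Hn Hchi].
  apply (Cmult_fixed_eq_0 (chi n) _ Hchi).
  rewrite <- csum_mult_l, <- (lsum_residues_mult_coprime q chi q_pos) with (n := n);
    [|apply chi_char|exact Hn].
  apply lsum_ext. intros k _. now rewrite char_mult.
Qed.

Lemma char_0 : ~ is_principal q chi -> chi 0%Z = RtoC 0.
Proof.
  intros Hchi. apply char_eq_0. simpl. rewrite Z.abs_eq by lia. intros Hq. apply Hchi.
  intros n _. rewrite <- char_1. apply char_congr. rewrite Hq. apply Z.divide_1_l.
Qed.

Lemma balanced_char :
  ~ is_principal q chi -> balanced_C (Z.to_nat q) (fun n => chi (Z.of_nat n)).
Proof.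
  intros Hchi. split.
  - lia.
  - intros n. apply char_congr. exists 1%Z. lia.
  - now apply char_0.
  - rewrite <- (lsum_map Z.of_nat chi). now apply char_sum_0.
Qed.

Lemma balanced_conj_char :
  ~ is_principal q chi -> balanced_C (Z.to_nat q) (fun n => conj_char chi (Z.of_nat n)).
Proof.
  intros Hchi. apply (balanced_morphism Cplus (RtoC 0) _ _ Cconj _ (fun n => chi (Z.of_nat n))).
  - exact Cconj_0.
  - apply Cplus_conj.
  - now apply balanced_char.
Qed.

Hypothesis chi_primitive : is_primitive q chi.

(* Primitivity provides [n = 1 mod q / gcd h q] with [chi n <> 1]; multiplying the summation
   variable by [n] leaves the sum unchanged. *)
Lemma twisted_gauss_sum_not_coprime h : Z.gcd h q <> 1%Z -> twisted_gauss_sum h = RtoC 0.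
Proof.
  intros Hh. assert (Hg0 := Z.gcd_nonneg h q).
  destruct (Z.gcd_divide_r h q) as [d Hd]. destruct (Z.gcd_divide_l h q) as [h' Hh'].
  set (g := Z.gcd h q) in *. clearbody g.
  destruct (chi_primitive d) as (n & Hn & Hn1 & Hchi); [nia|now exists g; lia|nia|].
  apply (Cmult_fixed_eq_0 (chi n) _ Hchi). unfold twisted_gauss_sum at 2.
  rewrite <- (lsum_residues_mult_coprime q _ q_pos (char_unity_root_periodic h) n Hn).
  unfold twisted_gauss_sum. rewrite <- csum_mult_l. apply lsum_ext. intros k _.
  rewrite char_mult, Cmult_assoc. f_equal. apply unity_root_congr; [exact q_pos|].
  destruct (divide_sub_mod n d) as [i Hi], (divide_sub_mod 1 d) as [j Hj].
  exists (- (k * h' * (i - j)))%Z.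
  replace (k * h - n * k * h)%Z with (- (k * h * (n - 1)))%Z by ring.
  replace (n - 1)%Z with ((i - j) * d)%Z by lia. rewrite Hd, Hh' at 1. ring.
Qed.

Lemma twisted_gauss_sum_primitive h :
  twisted_gauss_sum h = (gauss_sum q chi * Cconj (chi h))%C.
Proof.
  destruct (Z.eq_dec (Z.gcd h q) 1) as [Hh|Hh]; [now apply twisted_gauss_sum_coprime|].
  rewrite twisted_gauss_sum_not_coprime, char_eq_0, Cconj_0 by exact Hh. ring.
Qed.

Hypothesis chi_even : is_even_char chi.

Lemma char_opp n : chi (- n)%Z = chi n.
Proof. replace (- n)%Z with (-1 * n)%Z by ring. rewrite char_mult, chi_even. ring. Qed.

Lemma char_fourier d :
  (RtoC (IZR q) * chi d)%C
  = csum (fun h => (gauss_sum q chi * Cconj (chi h) * unity_root q (h * d))%C) (residues q).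
Proof.
  rewrite (lsum_ext _ (fun h =>
    csum (fun k => (chi k * unity_root q (h * (k + d)))%C) (residues q))).
  2:{ intros h _. rewrite <- twisted_gauss_sum_primitive, Cmult_comm.
      unfold twisted_gauss_sum. rewrite <- csum_mult_l. apply lsum_ext. intros k _.
      replace (h * (k + d))%Z with (k * h + h * d)%Z by ring. rewrite unity_root_plus. ring. }
  rewrite lsum_swap.
  rewrite (lsum_ext _ (fun k =>
      (chi k * (if Zdivide_dec q (k + d) then RtoC (IZR q) else RtoC 0))%C))
    by (intros k _; now rewrite csum_mult_l, csum_unity_root).
  assert (Hin : In ((- d) mod q)%Z (residues q)) by now apply in_residues, Z.mod_pos_bound.
  rewrite (lsum_single _ (residues q) ((- d) mod q)%Z (NoDup_residues q) Hin).
  - assert (Hd := divide_sub_mod (- d) q).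
    destruct (Zdivide_dec q ((- d) mod q + d)) as [_|N].
    + rewrite <- (char_congr _ _ Hd), char_opp. ring.
    + exfalso. apply N. destruct Hd as [k Hk]. exists (- k)%Z. lia.
  - intros k Hk Hne. destruct (Zdivide_dec q (k + d)) as [Hkd|_]; [|ring].
    exfalso. apply Hne, (residues_eq q); auto.
    destruct Hkd as [i Hi], (divide_sub_mod (- d) q) as [j Hj]. exists (i + j)%Z. lia.
Qed.

(* The average of [char_fourier] at [d] and [- d]. *)
Lemma char_cosine d :
  (RtoC (IZR q) * chi d)%C
  = csum (fun h => (gauss_sum q chi * Cconj (chi h) * RtoC (cos (2 * PI * IZR (h * d) / IZR q)))%C)
      (residues q).
Proof.
  assert (Eavg : forall z, z = (RtoC (/ 2) * (z + z))%C).
  { intros [x y]. unfold Cplus, Cmult. simpl. f_equal; field. }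
  rewrite (Eavg (_ * _)%C).
  rewrite (char_fourier d) at 1. rewrite <- (char_opp d), (char_fourier (- d)).
  rewrite <- lsum_op, <- csum_mult_l. apply lsum_ext. intros h _.
  rewrite <- Cmult_plus_distr_l, Cmult_assoc, (Cmult_comm (RtoC (/ 2))), <- Cmult_assoc. f_equal.
  unfold unity_root. replace (h * - d)%Z with (- (h * d))%Z by ring. rewrite opp_IZR.
  replace (2 * PI * - IZR (h * d) / IZR q) with (- (2 * PI * IZR (h * d) / IZR q))
    by (unfold Rdiv; ring).
  rewrite cos_neg, sin_neg. unfold Cplus, Cmult, RtoC. simpl. f_equal; field.
Qed.

Lemma even_mod_conj_char : even_mod (Z.to_nat q) (fun n => conj_char chi (Z.of_nat n)).
Proof.
  intros h Hh. unfold conj_char. f_equal. rewrite <- (char_opp (Z.of_nat h)).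
  apply char_congr. exists 1%Z. lia.
Qed.

Lemma char_cosine_nat d :
  (RtoC (INR (Z.to_nat q)) * chi (Z.of_nat d))%C
  = csum (fun h => (gauss_sum q chi * conj_char chi (Z.of_nat h)
                    * RtoC (cos (INR d * angle (Z.to_nat q) h)))%C) (seq 0 (Z.to_nat q)).
Proof.
  assert (Eq : INR (Z.to_nat q) = IZR q) by (rewrite INR_IZR_INZ, Z2Nat.id by lia; reflexivity).
  rewrite Eq, char_cosine. unfold residues. rewrite lsum_map. apply lsum_ext. intros h _.
  do 3 f_equal. unfold angle. rewrite Eq, mult_IZR, <- !INR_IZR_INZ. unfold Rdiv. ring.
Qed.

End DirichletCharacter.

(** * Koshliakov's formula for complex coefficients *)

Lemma CSeries_mult_l (z : C) (b : nat -> C) :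
  ex_series (fun n => fst (b n)) -> ex_series (fun n => snd (b n)) ->
  CSeries (fun n => (z * b n)%C) = (z * CSeries b)%C.
Proof.
  intros Hfst Hsnd.
  assert (Hscal : forall k (f : nat -> R), ex_series f -> ex_series (fun n => k * f n))
    by (intros k f; apply (ex_series_scal_l k f)).
  unfold CSeries, Cmult. simpl. f_equal; rewrite <- !Series_scal_l.
  - apply Series_minus; now apply Hscal.
  - apply Series_plus; now apply Hscal.
Qed.

Lemma CSeries_ext (a b : nat -> C) : (forall n, a n = b n) -> CSeries a = CSeries b.
Proof. intros E. unfold CSeries. f_equal; apply Series_ext; intros n; now rewrite E. Qed.

Lemma is_series_C (a : nat -> C) (l : C) :
  is_series (fun n => fst (a n)) (fst l) -> is_series (fun n => snd (a n)) (snd l) ->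
  is_series a l.
Proof.
  intros Hfst Hsnd. unfold is_series in *.
  assert (E : forall n,
      sum_n a n = (sum_n (fun n => fst (a n)) n, sum_n (fun n => snd (a n)) n) :> C).
  { induction n as [|n IH]; [rewrite !sum_O; apply surjective_pairing|].
    rewrite !sum_Sn, IH. reflexivity. }
  apply filterlim_locally. intros eps.
  generalize (filter_and _ _ (proj1 (filterlim_locally _ _) Hfst eps)
    (proj1 (filterlim_locally _ _) Hsnd eps)).
  apply filter_imp. intros n [Bfst Bsnd]. rewrite E. now split.
Qed.

Record real_linear (p : C -> R) : Prop := {
  real_linear_plus : forall z w, p (z + w)%C = p z + p w;
  real_linear_mult : forall z r, p (z * RtoC r)%C = p z * r
}.

Lemma real_linear_fst : real_linear fst.
Proof. split; intros; simpl; ring. Qed.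

Lemma real_linear_snd : real_linear snd.
Proof. split; intros; simpl; ring. Qed.

Lemma real_linear_0 p : real_linear p -> p (RtoC 0) = 0.
Proof.
  intros Hp. rewrite <- (Cmult_0_r (RtoC 0)), (real_linear_mult p Hp). ring.
Qed.

Lemma real_linear_csum p {A} (f : A -> C) l :
  real_linear p -> p (csum f l) = rsum (fun a => p (f a)) l.
Proof. intros Hp. apply lsum_morphism; [now apply real_linear_0|apply Hp]. Qed.

Lemma real_linear_div_INR p z n :
  real_linear p -> p (z / RtoC (INR (S n)))%C = p z / INR (S n).
Proof.
  intros Hp. unfold Cdiv. rewrite <- RtoC_inv by now apply not_0_INR.
  apply (real_linear_mult p Hp).
Qed.

Lemma real_linear_mult_l p (z : C) : real_linear p -> real_linear (fun x => p (z * x)%C).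
Proof.
  intros Hp. split.
  - intros x y. rewrite Cmult_plus_distr_l. apply (real_linear_plus p Hp).
  - intros x r. rewrite Cmult_assoc. apply (real_linear_mult p Hp).
Qed.

Section ComplexKoshliakov.

Variables (q : nat) (u w : nat -> C) (tau : C) (al : R).
Hypothesis w_balanced : balanced_C q w.
Hypothesis w_even : even_mod q w.
Hypothesis u_cosine : forall d, (RtoC (INR q) * u d)%C
  = csum (fun h => (tau * w h * RtoC (cos (INR d * angle q h)))%C) (seq 0 q).
Hypothesis al_pos : 0 < al.

Let c : R := al ^ 2 * INR q / (4 * PI ^ 2).
Hypothesis c_not_nat : forall m, (0 < m)%nat -> c <> INR m.
Lemma balanced_real_linear p : real_linear p -> balanced_R q (fun n => p (w n)).
Proof.
  intros Hp. apply (balanced_morphism Cplus (RtoC 0)); [now apply real_linear_0| |exact w_balanced].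
  apply (real_linear_plus p Hp).
Qed.

Lemma even_mod_real_linear (p : C -> R) : even_mod q (fun n => p (w n)).
Proof. intros h Hh. now rewrite w_even. Qed.

Lemma CSeries_L1_mult_l :
  CSeries (fun n => (tau * w (S n) / RtoC (INR (S n)))%C)
  = (tau * CSeries (fun n => (w (S n) / RtoC (INR (S n)))%C))%C.
Proof.
  assert (Hex : forall p, real_linear p ->
      ex_series (fun n => p (w (S n) / RtoC (INR (S n)))%C)).
  { intros p Hp.
    destruct (balanced_partial_sums_bounded q _ (balanced_real_linear p Hp)) as [B HB].
    apply (ex_series_ext (fun n => p (w (S n)) / INR (S n))).
    - intros n. symmetry. now apply real_linear_div_INR.
    - exact (ex_series_div_INR_S _ B HB). }
  rewrite <- CSeries_mult_l by (apply Hex; auto using real_linear_fst, real_linear_snd).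
  apply CSeries_ext. intros n. unfold Cdiv. ring.
Qed.

Lemma CSeries_log_kernel_mult_l :
  CSeries (fun n => (csum (fun d => tau * w d) (divisors (S n)) * RtoC (log_kernel c (S n)))%C)
  = (tau * CSeries (fun n => (csum w (divisors (S n)) * RtoC (log_kernel c (S n)))%C))%C.
Proof.
  assert (Hex : forall p, real_linear p ->
      ex_series (fun n => p (csum w (divisors (S n)) * RtoC (log_kernel c (S n)))%C)).
  { intros p Hp. destruct (is_RInt_line_poisson_avg_bose_regular q _ al
      (balanced_real_linear p Hp) (even_mod_real_linear p) al_pos c_not_nat) as (l & Hl & _).
    exists l. revert Hl. apply is_series_ext. intros n.
    now rewrite (real_linear_mult p Hp), real_linear_csum. }
  rewrite <- CSeries_mult_l by (apply Hex; auto using real_linear_fst, real_linear_snd).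
  apply CSeries_ext. intros n. rewrite csum_mult_l. ring.
Qed.

Lemma cosine_transform_real_linear p d :
  real_linear p -> cosine_transform q (fun n => p (tau * w n)%C) d = p (u d).
Proof.
  intros Hp. assert (Hq : 0 < INR q) by apply lt_0_INR, w_balanced.
  assert (E := f_equal p (u_cosine d)).
  rewrite Cmult_comm, (real_linear_mult p Hp), real_linear_csum in E by exact Hp.
  unfold cosine_transform. rewrite <- (lsum_ext (fun h => p (tau * w h * _)%C)
    (fun h => p (tau * w h)%C * cos (INR d * angle q h)))
    by (intros h _; apply (real_linear_mult p Hp)).
  rewrite <- E. field. lra.
Qed.

Lemma koshliakov_real_linear p : real_linear p ->
  is_series (fun n => p (csum u (divisors (S n)) * RtoC (K0 (2 * al * sqrt (INR (S n)))))%C)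
    (/ (2 * al ^ 2) * Series (fun n => p (u (S n) / RtoC (INR (S n)))%C)
     - / 8 * Series (fun n => p (tau * w (S n) / RtoC (INR (S n)))%C)
     + c / (2 * PI ^ 2) *
       Series (fun n =>
         p (csum (fun d => tau * w d) (divisors (S n)) * RtoC (log_kernel c (S n)))%C)).
Proof.
  intros Hp. assert (Htau := real_linear_mult_l p tau Hp).
  assert (Hu := fun d => cosine_transform_real_linear p d Hp).
  rewrite (Series_ext _ (fun n => p (u (S n)) / INR (S n)))
    by (intros n; now apply real_linear_div_INR).
  rewrite (Series_ext (fun n => p (tau * w (S n) / _)%C) (fun n => p (tau * w (S n))%C / INR (S n)))
    by (intros n; now apply real_linear_div_INR).
  rewrite (Series_ext (fun n => p (_ * RtoC (log_kernel c (S n)))%C)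
    (fun n => rsum (fun d => p (tau * w d)%C) (divisors (S n)) * log_kernel c (S n)))
    by (intros n; now rewrite (real_linear_mult p Hp), real_linear_csum).
  assert (K := koshliakov q _ al (balanced_real_linear _ Htau) (even_mod_real_linear _)
    al_pos c_not_nat).
  rewrite (Series_ext _ (fun n => p (u (S n)) / INR (S n))) in K by (intros n; now rewrite Hu).
  revert K. apply is_series_ext. intros n.
  rewrite (real_linear_mult p Hp), real_linear_csum by exact Hp. f_equal.
  apply lsum_ext. intros d _. apply Hu.
Qed.

Lemma koshliakov_C :
  is_series (fun n => (csum u (divisors (S n)) * RtoC (K0 (2 * al * sqrt (INR (S n)))))%C)
    (RtoC (/ (2 * al ^ 2)) * CSeries (fun n => (u (S n) / RtoC (INR (S n)))%C)
     - RtoC (/ 8) * (tau * CSeries (fun n => (w (S n) / RtoC (INR (S n)))%C))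
     + RtoC (c / (2 * PI ^ 2)) *
       (tau * CSeries (fun n => (csum w (divisors (S n)) * RtoC (log_kernel c (S n)))%C)))%C.
Proof.
  rewrite <- CSeries_L1_mult_l, <- CSeries_log_kernel_mult_l. apply is_series_C.
  - assert (K := koshliakov_real_linear fst real_linear_fst). revert K.
    match goal with |- is_series _ ?x -> is_series _ ?y => replace y with x; [auto|] end.
    simpl. ring.
  - assert (K := koshliakov_real_linear snd real_linear_snd). revert K.
    match goal with |- is_series _ ?x -> is_series _ ?y => replace y with x; [auto|] end.
    simpl. ring.
Qed.

End ComplexKoshliakov.

Lemma koshliakov_char q chi al :
  is_dirichlet_char q chi -> ~ is_principal q chi -> is_even_char chi -> is_primitive q chi ->
  0 < al ->
  let c := al ^ 2 * IZR q / (4 * PI ^ 2) in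
  (forall m, (0 < m)%nat -> c <> INR m) ->
  is_series (fun n => (d_chi chi (S n) * RtoC (K0 (2 * al * sqrt (INR (S n)))))%C)
    (RtoC (/ (2 * al ^ 2)) * L1 chi
     - RtoC (/ 8) * (gauss_sum q chi * L1 (conj_char chi))
     + RtoC (c / (2 * PI ^ 2)) *
       (gauss_sum q chi * CSeries (fun n => (d_chi (conj_char chi) (S n)
          * RtoC (log_kernel c (S n)))%C)))%C.
Proof.
  intros Hchi Hnp Heven Hprim Hal.
  replace (IZR q) with (INR (Z.to_nat q))
    by (rewrite INR_IZR_INZ, Z2Nat.id by (destruct Hchi; lia); reflexivity).
  exact (koshliakov_C (Z.to_nat q) (fun n => chi (Z.of_nat n))
    (fun n => conj_char chi (Z.of_nat n)) (gauss_sum q chi) al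
    (balanced_conj_char q chi Hchi Hnp) (even_mod_conj_char q chi Hchi Heven)
    (char_cosine_nat q chi Hchi Hprim Heven) Hal).
Qed.

Theorem theorem2p9 (q : Z) (chi : Z -> C) (a x : R) :
  is_dirichlet_char q chi ->
  ~ is_principal q chi ->
  is_even_char chi ->
  is_primitive q chi ->
  0 < a -> 0 < x ->
  (forall m : nat, (0 < m)%nat -> a ^ 2 * IZR q * x / (16 * PI ^ 2) <> INR m) ->
  let c := a ^ 2 * IZR q * x / (16 * PI ^ 2) in
  is_series
    (fun n : nat =>
       Cmult (d_chi chi (S n)) (RtoC (K0 (a * sqrt (INR (S n) * x)))))
    (Cplus
       (Cminus
          (Cmult (RtoC (2 / (a ^ 2 * x))) (L1 chi))
          (Cmult (Cdiv (gauss_sum q chi) (RtoC 8)) (L1 (conj_char chi))))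
       (Cmult (RtoC (a ^ 2 * IZR q * x / (32 * PI ^ 4)))
          (Cmult (gauss_sum q chi)
             (CSeries (fun n : nat =>
                Cmult (d_chi (conj_char chi) (S n))
                  (RtoC (ln (INR (S n) / c) / (INR (S n) ^ 2 - c ^ 2)))))))).
Proof.
  intros Hchi Hnp Heven Hprim Ha Hx Hc c. assert (HPI := PI_RGT_0).
  assert (Sx := sqrt_lt_R0 x Hx). assert (Ex := sqrt_sqrt x ltac:(lra)).
  set (al := a * sqrt x / 2).
  assert (Hal : 0 < al) by (apply Rdiv_lt_0_compat; [now apply Rmult_lt_0_compat|lra]).
  assert (Eal : al ^ 2 = a ^ 2 * x / 4) by (unfold al; rewrite <- Ex at 2; field).
  assert (Ec : al ^ 2 * IZR q / (4 * PI ^ 2) = c) by (unfold c; rewrite Eal; field; lra).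
  assert (K := koshliakov_char q chi al Hchi Hnp Heven Hprim Hal). rewrite Ec in K.
  replace (2 / (a ^ 2 * x)) with (/ (2 * al ^ 2)) by (rewrite Eal; field; lra).
  replace (a ^ 2 * IZR q * x / (32 * PI ^ 4)) with (c / (2 * PI ^ 2)) by (unfold c; field; lra).
  replace (gauss_sum q chi / RtoC 8 * L1 (conj_char chi))%C
    with (RtoC (/ 8) * (gauss_sum q chi * L1 (conj_char chi)))%C
    by (rewrite RtoC_inv by lra; unfold Cdiv; ring).
  generalize (K Hc). apply is_series_ext. intros n. do 3 f_equal.
  rewrite sqrt_mult by (lra || apply pos_INR). unfold al. field.
Qed.
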